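(* Let $W$ be the dihedral group generated by involutions $s,t$ with $st$ of finite order $m\ge2$, and fix a balanced symmetric realization over $\Bbbk$ satisfying Demazure surjectivity, local non-degeneracy and lesser invertibility. Equip $R^s\subset R$ and $R^t\subset R$ with the traces $\partial_s,\partial_t$, $R^W\subset R$ with $\partial_W=\partial_s\partial_t\cdots$ ($m$ factors), $R^W\subset R^s$ with $\partial^s_W$ = the composite of $m-1$ alternating Demazure operators in which $\partial_t$ is applied first (so $\partial_W=\partial^s_W\circ\partial_s$), and $R^W\subset R^t$ with $\partial^t_W$ defined symmetrically (so $\partial_W=\partial^t_W\circ\partial_t$). Then $R^W\subset R^s,R^t\subset R$ is a (compatible) graded Frobenius square. Consequently $R(m)$ is a free graded $R^W$-module of graded rank $[W]$, and for $i\in\{s,t\}$, $R^i(m-1)$ is a free graded $R^W$-module of graded rank $[W]/(v+v^{-1})$. Moreover, for any choice of dual bases the following hold: (1) $\Lambda_W=\Lambda$; (2) $\partial_W(\Lambda)=2m$; (3) $\Lambda^s_W=\Lambda/\alpha_s$; (4) $\partial^s_W(\Lambda^s_W)=m$; (5) $\Delta^s_{W(1)}\,\partial_t(\Delta^s_{W(2)})=\partial_t(\Delta^s_{W(1)})\,\Delta^s_{W(2)}=\frac{\Lambda}{\alpha_s\alpha_t}$ (where elements of $R^s$ are regarded in $R$ to apply $\partial_t$); (6) for every $f\in R$, $\Delta^s_{W(1)}\otimes\partial_t(f\Delta^s_{W(2)})=\partial_s(f\Delta^t_{W(1)})\otimes\Delta^t_{W(2)}$ in $R^s\otimes_{R^W}R^t$.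 In particular the map $R\to R^s\otimes_{R^W}R^t$, $f\mapsto\Delta^s_{W(1)}\otimes\partial_t(f\Delta^s_{W(2)})=\partial_s(f\Delta^t_{W(1)})\otimes\Delta^t_{W(2)}$, is well-defined, left $R^s$-linear and right $R^t$-linear.
   Context: Quantum numbers: $[0]=0,[1]=1,[k+1]=[2][k]-[k-1]$ for a fixed $[2]\in\Bbbk$. Balanced symmetric realization: free finite-rank $\mathfrak h$ with $\alpha_s^\vee,\alpha_t^\vee\in\mathfrak h$, $\alpha_s,\alpha_t\in\mathfrak h^*$, $\langle\alpha_u^\vee,\alpha_u\rangle=2$, $\langle\alpha_s^\vee,\alpha_t\rangle=\langle\alpha_t^\vee,\alpha_s\rangle=-[2]$, $[m]=0$, $[m-1]=1$, and $u(x)=x-\langle x,\alpha_u\rangle\alpha_u^\vee$ defines a $W$-action on $\mathfrak h$ (hence on $\mathfrak h^*$ and $R=\mathrm{Sym}(\mathfrak h^* )$, graded with $\mathfrak h^*$ in degree 2). $R^J$: invariants of the subgroup generated by $J$; $R^W=R^{\{s,t\}}$. Demazure surjectivity: $\langle-,\alpha_u\rangle\colon\mathfrak h\to\Bbbk$ and $\langle\alpha_u^\vee,-\rangle\colon\mathfrak h^*\to\Bbbk$ surjective for $u=s,t$; then $\partial_u(f)=(f-u(f))/\alpha_u$ defines $\partial_u\colon R\to R^u$. Local non-degeneracy: $4-[2]^2$ invertible. Lesser invertibility: $[k]$ invertible for $1\le k<m$, and $s,t$ act with order 2 and $st$ with order $m$. A Frobenius extension $A\subset B$ of commutative rings with trace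 $\partial\colon B\to A$: $B$ is free of finite rank over $A$, $\partial$ is $A$-linear and the pairing $(f,g)\mapsto\partial(fg)$ is perfect, i.e. there are bases $\{f_i\},\{f_i^*\}$ of $B$ over $A$ with $\partial(f_if_j^* )=\delta_{ij}$. Its comultiplication element is $\Delta=\sum_i f_i\otimes f_i^*\in B\otimes_AB$ (independent of the bases), written in Sweedler notation $\Delta_{(1)}\otimes\Delta_{(2)}$, and $\Lambda=\mu(\Delta)=\sum_if_if_i^*\in B$. We write $\Delta_W,\Lambda_W$ for $R^W\subset R$, $\Delta^s_W,\Lambda^s_W$ for $R^W\subset R^s$, $\Delta^t_W,\Lambda^t_W$ for $R^W\subset R^t$. A compatible Frobenius square means all four edge extensions are Frobenius with the given traces and the composite traces agree: $\partial^s_W\partial_s=\partial^t_W\partial_t=\partial_W$. Graded rank of a free graded module with homogeneous basis $\{b_i\}$ is $\sum_iv^{\deg b_i}$; $M(k)^i=M^{i+k}$. $[W]=v^{-m}\sum_{w\in W}v^{2\ell(w)}$. Roots: for $k\ge0$ let $f_{s,k}=x(\alpha_s)$ where $x\in W$ is the alternating product of $s,t$ of length $k$ whose rightmost letter is $t$, and $f_{t,k}$ likewise with $s,t$ swapped. $\Lambda$ is the product of the positive roots: if $m=2k$, $\Lambda=\prod_{l=0}^{k-1}f_{s,l}f_{t,l}$; if $m$ is odd, $\Lambda=\prod_{l=0}^{m-1}f_{s,l}$. *)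

(* Defs.v *)
From HB Require Import structures.
From mathcomp Require Import all_boot all_order all_algebra.
From mathcomp Require Import mpoly.
From Stdlib Require Import ClassicalEpsilon.
Set Implicit Arguments. Unset Strict Implicit. Unset Printing Implicit Defensive.
Import GRing.Theory.
Local Open Scope ring_scope.

(* Conventions.
   h = k^n (row vectors), h^* = k^n via the dual basis; the pairing
   <x, phi> = \sum_i x_i phi_i.  R = Sym(h^* ) = {mpoly k[n]}, the variable
   'X_i being the i-th dual basis vector; a polynomial of (mpoly) total degree
   d has degree 2d in the grading of the paper (h^* in degree 2). *)

Section Defs.
Variables (k : comNzRingType) (n : nat).
Local Notation R := {mpoly k[n]}.

Definition pairing (x phi : 'rV[k]_n) : k := \sum_(i < n) x 0 i * phi 0 i.

Fixpoint qnum (a2 : k) (j : nat) : k :=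
  match j with
  | 0 => 0
  | 1 => 1
  | S ((S j') as j1) => a2 * qnum a2 j1 - qnum a2 j'
  end.

Definition refl_h (cor rt : 'rV[k]_n) (x : 'rV[k]_n) : 'rV[k]_n :=
  x - pairing x rt *: cor.
Definition refl_hs (cor rt : 'rV[k]_n) (phi : 'rV[k]_n) : 'rV[k]_n :=
  phi - pairing cor phi *: rt.

Definition linp (phi : 'rV[k]_n) : R := \sum_(i < n) phi 0 i *: 'X_i.

Definition actR (cor rt : 'rV[k]_n) (f : R) : R :=
  f \mPo [tuple linp (refl_hs cor rt (delta_mx 0 i)) | i < n].

(* Demazure operator: partial_u f = (f - u f) / alpha_u, i.e. the (unique,
   under Demazure surjectivity) g with alpha_u * g = f - u f. *)
Definition demazure (cor rt : 'rV[k]_n) (f : R) : R :=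
  epsilon (inhabits 0) (fun g : R => linp rt * g = f - actR cor rt f).

Definition invariants (cor rt : 'rV[k]_n) : pred R :=
  fun f => actR cor rt f == f.

End Defs.

Fixpoint altL (T : Type) (d1 d2 : T -> T) (j : nat) (x : T) : T :=
  match j with 0 => x | S j' => d1 (altL d2 d1 j' x) end.
Fixpoint altF (T : Type) (d1 d2 : T -> T) (j : nat) (x : T) : T :=
  match j with 0 => x | S j' => altF d2 d1 j' (d1 x) end.

Section Defs2.
Variables (k : comNzRingType) (n : nat).
Local Notation R := {mpoly k[n]}.

Definition root_s (acs act as_ at_ : 'rV[k]_n) (l : nat) : 'rV[k]_n :=
  altF (refl_hs act at_) (refl_hs acs as_) l as_.
Definition root_t (acs act as_ at_ : 'rV[k]_n) (l : nat) : 'rV[k]_n :=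
  altF (refl_hs acs as_) (refl_hs act at_) l at_.

(* Lambda = product of the positive roots *)
Definition Lambda (m : nat) (acs act as_ at_ : 'rV[k]_n) : R :=
  if ~~ odd m then
    \prod_(l < m./2) (linp (root_s acs act as_ at_ l) * linp (root_t acs act as_ at_ l))
  else \prod_(l < m) linp (root_s acs act as_ at_ l).

Definition is_basis (A B : pred R) (N : nat) (b : 'I_N -> R) : Prop :=
  (forall i, b i \in B) /\
  (forall f, f \in B -> exists c : 'I_N -> R,
      (forall i, c i \in A) /\ f = \sum_(i < N) c i * b i) /\
  (forall c c' : 'I_N -> R, (forall i, c i \in A) -> (forall i, c' i \in A) ->
      \sum_(i < N) c i * b i = \sum_(i < N) c' i * b i -> forall i, c i = c' i).

(* homogeneous basis; b i has mpoly-degree d i, i.e. degree 2 * d i *)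
Definition graded_basis (A B : pred R) (N : nat) (b : 'I_N -> R)
    (d : 'I_N -> nat) : Prop :=
  is_basis A B b /\ forall i, b i \is (d i).-homog.

Definition dual_bases (A B : pred R) (tr : R -> R) (N : nat)
    (b b' : 'I_N -> R) : Prop :=
  is_basis A B b /\ is_basis A B b' /\
  forall i j, tr (b i * b' j) = (i == j)%:R.

Definition graded_frobenius (A B : pred R) (tr : R -> R) : Prop :=
  (forall f, f \in B -> tr f \in A) /\
  (forall a f g, a \in A -> f \in B -> g \in B ->
      tr (a * f + g) = a * tr f + tr g) /\
  exists N (b b' : 'I_N -> R) (d d' : 'I_N -> nat),
    graded_basis A B b d /\ graded_basis A B b' d' /\
    forall i j, tr (b i * b' j) = (i == j)%:R.

(* Equality of two elements  sum_p p.1 (x) p.2  of M ⊗_A N (M, N subsets of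
   R that are A-modules), characterised by the universal property of the
   tensor product: they agree under every A-balanced biadditive map. *)
Definition tensor_eq (A M N : pred R) (xs ys : seq (R * R)) : Prop :=
  all (fun p => (p.1 \in M) && (p.2 \in N)) xs /\
  all (fun p => (p.1 \in M) && (p.2 \in N)) ys /\
  forall (P : zmodType) (beta : R -> R -> P),
    (forall x x' y, x \in M -> x' \in M -> y \in N ->
        beta (x + x') y = beta x y + beta x' y) ->
    (forall x y y', x \in M -> y \in N -> y' \in N ->
        beta x (y + y') = beta x y + beta x y') ->
    (forall a x y, a \in A -> x \in M -> y \in N ->
        beta (a * x) y = beta x (a * y)) ->
    \sum_(p <- xs) beta p.1 p.2 = \sum_(p <- ys) beta p.1 p.2.

End Defs2.

(* lengths l(w) of the elements w of the dihedral group of order 2m: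
   the identity, two elements of each length 1..m-1, the longest element *)
Definition dihedral_lengths (m : nat) : seq nat :=
  0%N :: flatten [seq [:: l; l] | l <- iota 1 m.-1] ++ [:: m].

(* [W] = v^{-m} sum_w v^{2 l(w)}, as the multiset of its exponents *)
Definition W_exponents (m : nat) : seq int :=
  [seq (2 * l)%:Z - m%:Z | l <- dihedral_lengths m].

(* Main.v *)
Require Import Defs.
From HB Require Import structures.
From mathcomp Require Import all_boot all_order all_algebra.
From mathcomp Require Import mpoly ring zify.
From Stdlib Require Import ClassicalEpsilon.
Set Implicit Arguments. Unset Strict Implicit. Unset Printing Implicit Defensive.
Import GRing.Theory.
Local Open Scope ring_scope.

(** In rank two every alternating word of Demazure operators satisfies a
    Leibniz rule with only two correction terms, because omitting an inner
    letter produces a square.  For words of length m the correction terms of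
    the two words are exchanged since [m-1] = 1, so the difference of the two
    words is a twisted R-linear map killing 1: this is the braid relation.

    Let v_0, v_1, ... be the images of a fundamental weight under alternating
    words.  The products v_0 ... v_{l-1} are mapped to one another, up to
    quantum integers, by successive Demazure operators.  This gives an element
    of degree m and trace 1, whose iterated Demazure images form a basis of R^s
    over R^W with one element in each degree 0, ..., m-1 and with a triangular
    Gram matrix.  The extension R^s of R is free on 1 and a fundamental weight.

    For dual bases b, b' of R^s over R^W put M_j = sum_i b_i T_j(b'_i), with T_j
    the word of length j beginning with the operator of t.  Commuting v_0
    through the comultiplication element yields (v_0 - v_j) M_j = [j] M_{j-1},
    with M_{m-1} = 1, and each v_0 - v_j is a quantum integer times a positive
    root; hence alpha_s M_0 is the product of the positive roots.  Both sides
    of (6) expand to the same double sum over dual bases. *)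

(** * Linear forms in the polynomial ring *)

Section LinearForms.
Variables (k : comNzRingType) (n : nat).
Implicit Types (x phi psi : 'rV[k]_n) (f g : {mpoly k[n]}).

Lemma pairingD x phi psi : pairing x (phi + psi) = pairing x phi + pairing x psi.
Proof.
by rewrite /pairing -big_split; apply: eq_bigr => i _; rewrite mxE mulrDr.
Qed.

Lemma pairingZ x a phi : pairing x (a *: phi) = a * pairing x phi.
Proof.
by rewrite /pairing mulr_sumr; apply: eq_bigr => i _; rewrite mxE mulrCA.
Qed.

Lemma pairingN x phi : pairing x (- phi) = - pairing x phi.
Proof. by rewrite -scaleN1r pairingZ mulN1r. Qed.

Lemma pairing_refl x cor rt phi :
  pairing x (refl_hs cor rt phi) = pairing x phi - pairing cor phi * pairing x rt.
Proof. by rewrite pairingD pairingN pairingZ. Qed.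

Lemma linpD phi psi : linp (phi + psi) = linp phi + linp psi.
Proof. by rewrite /linp -big_split; apply: eq_bigr => i _; rewrite mxE scalerDl. Qed.

Lemma linpZ a phi : linp (a *: phi) = a *: linp phi.
Proof. by rewrite /linp scaler_sumr; apply: eq_bigr => i _; rewrite mxE scalerA. Qed.

Lemma linpN phi : linp (- phi) = - linp phi.
Proof. by rewrite -scaleN1r linpZ scaleN1r. Qed.

Lemma linp_delta i : linp (delta_mx 0 i) = 'X_i :> {mpoly k[n]}.
Proof.
rewrite /linp (bigD1 i) //= !mxE !eqxx scale1r big1 ?addr0 // => j ji.
by rewrite !mxE (negPf ji) andbF scale0r.
Qed.

Lemma linp_homog phi : linp phi \is 1.-homog.
Proof.
by apply: rpred_sum => i _; apply: rpredZ; rewrite dhomogX /= mdeg1.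
Qed.

Lemma mdeg_gt0_exists d (m : 'X_{1..n}) : mdeg m = d.+1 -> exists j, m j != 0%N.
Proof.
move=> dm; apply/existsP; apply: contra_eqT dm; rewrite negb_exists => /forallP m0.
by rewrite mdegE big1 // => j _; apply/eqP; rewrite -[_ == _]negbK m0.
Qed.

(** A monomial of positive degree has a variable as a factor, so monomials follow by induction on
    the degree. The zero polynomial is reached as [0 *: 1]. *)
Lemma mpoly_gen_ind (P : {mpoly k[n]} -> Prop) :
  P 1 -> (forall a f, P f -> P (a *: f)) ->
  (forall f g, P f -> P g -> P (f + g)) ->
  (forall i f, P f -> P ('X_i * f)) -> forall f, P f.
Proof.
move=> P1 PZ PD PX f.
have PM (m : 'X_{1..n}) : P 'X_[m].
  have [d] := ubnP (mdeg m); elim: d m => // d IH m.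
  case dm: (mdeg m) => [|e].
    by move/eqP: dm; rewrite mdeg_eq0 => /eqP-> _; rewrite mpolyX0.
  rewrite ltnS => le_ed; have [i mi] := mdeg_gt0_exists dm.
  have le1 : (U_(i) <= m)%MM by rewrite lep1mP.
  rewrite -(submK le1) addmC mpolyXD; apply/PX/IH; apply: leq_trans le_ed.
  by rewrite -dm -{2}(submK le1) mdegD mdeg1 addn1.
rewrite (mpolyE f); apply: (big_ind P) => [||m _]; [|exact: PD|exact/PZ/PM].
by rewrite -(scale0r 1); apply: PZ.
Qed.

(* Under [X_i |-> X_i + x_i T] the form [linp phi] becomes [linp phi + T],
   which is monic in [T]. *)
Lemma linp_nonzerodivisor x phi f g :
  pairing x phi = 1 -> linp phi * f = linp phi * g -> f = g.
Proof.
move=> x1 /eqP; rewrite -subr_eq0 -mulrBr => /eqP eq0; apply: subr0_eq.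
set h := f - g in eq0 *.
pose c : k -> {poly {mpoly k[n]}} := fun a => (a%:MP)%:P.
pose t i : {poly {mpoly k[n]}} := ('X_i)%:P + ((x 0 i)%:MP)%:P * 'X.
pose sh (p : {mpoly k[n]}) := mmap (polyC \o @mpolyC n k) t p.
have shD p q : sh (p + q) = sh p + sh q by apply: mmapD.
have shM p q : sh (p * q) = sh p * sh q by exact: rmorphM.
have shphi : sh (linp phi) = 'X + (linp phi)%:P.
  rewrite /sh /linp rmorph_sum /=.
  under eq_bigr do rewrite mmapZ mmapX mmap1U /t mulrDr mulrCA mulrA.
  rewrite big_split /= addrC; congr (_ + _).
    rewrite -mulr_suml -[RHS]mul1r; congr (_ * _).
    under eq_bigr do rewrite -!rmorphM.
    by rewrite -!rmorph_sum /= -[\sum_i _]/(pairing x phi) x1.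
  by rewrite rmorph_sum; apply: eq_bigr => i _; rewrite -mul_mpolyC rmorphM.
(* Setting T = 0 undoes the substitution, so [sh h = 0] forces [h = 0]. *)
have hor0 p : (sh p).[0] = p.
  elim/mpoly_gen_ind: p => [|a p IH|p q IHp IHq|i p IH].
  - by rewrite /sh rmorph1 hornerC.
  - by rewrite /sh mmapZ hornerM hornerC IH mul_mpolyC.
  - by rewrite shD hornerD; congr (_ + _).
  - rewrite shM hornerM; congr (_ * _) => //.
    by rewrite /sh mmapX mmap1U /t !hornerE ?mulr0 ?addr0.
have : sh (linp phi) * sh h = 0 by rewrite -shM eq0 /sh mmap0.
rewrite shphi => /eqP; rewrite mulrC mulIr_eq0.
  by move/eqP => h0; rewrite -(hor0 h) h0 horner0.
by apply: monic_rreg; rewrite -[linp phi]opprK polyCN monicXsubC.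
Qed.

End LinearForms.

(** * A single reflection and its Demazure operator *)

Section Reflection.
Variables (k : comNzRingType) (n : nat) (cor rt : 'rV[k]_n).
Hypothesis cor_rt : pairing cor rt = 2.
Hypothesis surj : exists x, pairing x rt = 1.
Implicit Types (phi : 'rV[k]_n) (f g : {mpoly k[n]}).

Local Notation s := (actR cor rt).
Local Notation d := (demazure cor rt).

Lemma actRD f g : s (f + g) = s f + s g. Proof. exact: comp_mpolyD. Qed.
Lemma actRZ a f : s (a *: f) = a *: s f. Proof. exact: comp_mpolyZ. Qed.
Lemma actRM f g : s (f * g) = s f * s g. Proof. exact: rmorphM. Qed.
Lemma actR1 : s 1 = 1. Proof. exact: comp_mpoly1. Qed.
Lemma actRN f : s (- f) = - s f. Proof. by rewrite -scaleN1r actRZ scaleN1r. Qed.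
Lemma actRB f g : s (f - g) = s f - s g. Proof. by rewrite actRD actRN. Qed.

Lemma actR_linp phi : s (linp phi) = linp (refl_hs cor rt phi).
Proof.
rewrite {1}/linp /actR raddf_sum /=.
under eq_bigr => i _ do rewrite comp_mpolyZ comp_mpolyXU -tnth_nth tnth_mktuple
  /refl_hs linpD linpN linpZ linp_delta scalerDr.
rewrite big_split /= /refl_hs linpD linpN linpZ; congr (_ + _).
under eq_bigr => i _ do rewrite scalerN scalerA.
rewrite -[LHS]opprK; congr (- _); rewrite -sumrN.
under eq_bigr => i _ do rewrite opprK.
rewrite -scaler_suml; congr (_ *: _); apply: eq_bigr => i _.
rewrite mulrC /pairing (bigD1 i) //= !mxE !eqxx mulr1 big1 ?addr0 // => j ji.
by rewrite !mxE (negPf ji) andbF mulr0.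
Qed.

Lemma refl_hsK phi : refl_hs cor rt (refl_hs cor rt phi) = phi.
Proof.
rewrite /refl_hs pairingD pairingN pairingZ cor_rt -addrA -opprD -scalerDl.
set A := pairing _ _; have -> : A + (A - A * 2) = 0 by ring.
by rewrite scale0r subr0.
Qed.

Lemma actRK f : s (s f) = f.
Proof.
elim/mpoly_gen_ind: f => [|a f IH|f g IHf IHg|i f IH].
- by rewrite !actR1.
- by rewrite !actRZ IH.
- by rewrite !actRD IHf IHg.
- by rewrite !actRM IH -linp_delta !actR_linp refl_hsK.
Qed.

Lemma actR_root : s (linp rt) = - linp rt.
Proof.
rewrite actR_linp /refl_hs cor_rt -linpN; congr linp.
by rewrite scaler_nat mulr2n opprD addNKr.
Qed.

(** [demazure] is a chosen quotient, so divisibility of [f - s f] by the root has to be established;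
    for ['X_i * f] the twisted Leibniz rule supplies the witness. *)
Lemma demazureP f : linp rt * d f = f - s f.
Proof.
apply: (epsilon_spec (inhabits 0) (fun g => linp rt * g = f - s f)).
elim/mpoly_gen_ind: f => [|a f [h E]|f g [hf Ef] [hg Eg]|i f [h E]].
- by exists 0; rewrite actR1 mulr0 subrr.
- by exists (a *: h); rewrite -scalerAr E actRZ scalerBr.
- by exists (hf + hg); rewrite mulrDr Ef Eg actRD; ring.
- exists (pairing cor (delta_mx 0 i) *: f + s 'X_i * h).
  rewrite mulrDr mulrCA E actRM -linp_delta actR_linp /refl_hs.
  by rewrite linpD linpN linpZ -!mul_mpolyC; ring.
Qed.

(** The root is a nonzerodivisor by surjectivity, so identities between Demazure images can be
    checked after multiplication by it. *)
Lemma demazure_uniq f g : linp rt * g = f - s f -> d f = g.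
Proof. by case: surj => x x1 E; apply: (linp_nonzerodivisor x1); rewrite demazureP. Qed.

Lemma demazureD f g : d (f + g) = d f + d g.
Proof. by apply: demazure_uniq; rewrite mulrDr !demazureP actRD; ring. Qed.

Lemma demazureZ a f : d (a *: f) = a *: d f.
Proof. by apply: demazure_uniq; rewrite -scalerAr demazureP actRZ scalerBr. Qed.

Lemma demazureN f : d (- f) = - d f.
Proof. by rewrite -scaleN1r demazureZ scaleN1r. Qed.

Lemma demazureB f g : d (f - g) = d f - d g.
Proof. by rewrite demazureD demazureN. Qed.

Lemma demazure0 : d 0 = 0.
Proof. by have := demazureZ 0 0; rewrite !scale0r. Qed.

Lemma demazureM f g : d (f * g) = d f * g + s f * d g.
Proof.
apply: demazure_uniq.
by rewrite mulrDr mulrA demazureP mulrCA demazureP actRM; ring.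
Qed.

Lemma demazure_linp phi : d (linp phi) = (pairing cor phi)%:MP.
Proof.
apply: demazure_uniq; rewrite actR_linp /refl_hs linpD linpN linpZ -mul_mpolyC.
by ring.
Qed.

Lemma invariantsP f : reflect (d f = 0) (f \in invariants cor rt).
Proof.
apply: (iffP eqP) => [sf|df]; first by apply: demazure_uniq; rewrite sf subrr mulr0.
by apply/esym/subr0_eq; rewrite -demazureP df mulr0.
Qed.

(** The reflection negates both the root and [f - s f], hence fixes the quotient. *)
Lemma demazure_invar f : d f \in invariants cor rt.
Proof.
apply/eqP; case: surj => x x1; apply: (linp_nonzerodivisor x1).
rewrite demazureP -[linp rt]opprK -actR_root mulNr -actRM demazureP actRB actRK.
by rewrite opprB.
Qed.

Lemma demazureK f : d (d f) = 0.
Proof. exact/invariantsP/demazure_invar. Qed.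

Lemma demazureMl f g : f \in invariants cor rt -> d (f * g) = f * d g.
Proof. by move=> fI; rewrite demazureM (invariantsP _ fI) mul0r add0r (eqP fI). Qed.

Lemma demazureMr f g : g \in invariants cor rt -> d (f * g) = d f * g.
Proof. by move=> gI; rewrite mulrC demazureMl // mulrC. Qed.

Lemma demazure1 : d 1 = 0.
Proof. by apply/invariantsP/eqP/actR1. Qed.

Lemma demazureC a : d a%:MP = 0.
Proof. by rewrite -[_%:MP]mulr1 mul_mpolyC demazureZ demazure1 scaler0. Qed.

Lemma demazure_homog i f : f \is i.+1.-homog -> d f \is i.-homog.
Proof.
move=> hf; rewrite (mpolyE f).
have dsum (r : seq 'X_{1..n}) (F : 'X_{1..n} -> {mpoly k[n]}) :
    d (\sum_(m <- r) F m) = \sum_(m <- r) d (F m).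
  by apply: (big_morph _ demazureD demazure0).
rewrite dsum big_seq; apply: rpred_sum => m mf; rewrite demazureZ; apply: rpredZ.
have {mf} : mdeg m = i.+1 by exact: (dhomog_mf hf mf).
elim: i m {hf} => [|i IH] m dm; have [j mj] := mdeg_gt0_exists dm.
- have le1 : (U_(j) <= m)%MM by rewrite lep1mP.
  have : mdeg (m - U_(j))%MM = 0.
    by apply: succn_inj; rewrite -dm -{2}(submK le1) mdegD mdeg1 addn1.
  move/eqP; rewrite mdeg_eq0 => /eqP m0.
  rewrite -(submK le1) m0 add0m -linp_delta demazure_linp -[_%:MP]mulr1 mul_mpolyC.
  by rewrite rpredZ ?dhomog1.
- have le1 : (U_(j) <= m)%MM by rewrite lep1mP.
  have dm' : mdeg (m - U_(j))%MM = i.+1.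
    by apply: succn_inj; rewrite -dm -{2}(submK le1) mdegD mdeg1 addn1.
  rewrite -(submK le1) addmC mpolyXD demazureM; apply: rpredD.
    by rewrite -linp_delta demazure_linp mul_mpolyC rpredZ // dhomogX /= dm'.
  rewrite -linp_delta actR_linp -[i.+1]add1n.
  by apply: dhomogM; [exact: linp_homog | exact: IH].
Qed.

End Reflection.

(** * Alternating words and quantum numbers *)

Lemma addbNN (b e : bool) : ~~ b (+) ~~ e = b (+) e.
Proof. by rewrite addbN addNb negbK. Qed.

Section AlternatingWords.
Variables (T : Type) (D : bool -> T -> T).

(** The letter [D b] is applied first, and the letter applied after [j] others is
    [D (b (+) odd j)]. *)
Definition alt b j x := altF (D b) (D (~~ b)) j x.

Lemma altSl b j x : alt b j.+1 x = alt (~~ b) j (D b x).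
Proof. by rewrite /alt /= negbK. Qed.

Lemma altSr b j x : alt b j.+1 x = D (b (+) odd j) (alt b j x).
Proof.
elim: j b x => [|j IH] b x; first by rewrite /alt /= addbF.
by rewrite altSl IH altSl /= addNb addbN.
Qed.

Lemma altD b i j x : alt b (i + j) x = alt (b (+) odd i) j (alt b i x).
Proof.
elim: i b x => [|i IH] b x; first by rewrite addbF.
by rewrite addSn !altSl IH /= addNb addbN.
Qed.

(** [altL] prescribes the outermost letter and [alt] the innermost one; the two conventions differ
    by the parity of the length. *)
Lemma altL_alt b j x : altL (D b) (D (~~ b)) j x = alt (~~ b (+) odd j) j x.
Proof.
elim: j b => [|j IH] b //=; have := IH (~~ b); rewrite negbK => ->.
have -> : ~~ b (+) odd j.+1 = b (+) odd j by exact: addbNN.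
by rewrite altSr -addbA addbb addbF.
Qed.

End AlternatingWords.

Local Arguments qnum : simpl never.

Section QuantumNumbers.
Variables (k : comNzRingType) (a : k).
Local Notation q := (qnum a).

Lemma qnum0 : q 0 = 0. Proof. by []. Qed.
Lemma qnum1 : q 1 = 1. Proof. by []. Qed.
Lemma qnumSS j : q j.+2 = a * q j.+1 - q j. Proof. by []. Qed.

Lemma qnum_add i j : q (i + j).+1 = q i.+1 * q j.+1 - q i * q j.
Proof.
(* The recursion has order two, so the induction carries two consecutive values of [i]. *)
suff: q (i + j).+1 = q i.+1 * q j.+1 - q i * q j /\
      q (i.+1 + j).+1 = q i.+2 * q j.+1 - q i.+1 * q j by case.
elim: i => [|i [IH1 IH2]].
  by rewrite add0n add1n !qnumSS qnum1 qnum0; split; ring.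
split=> //; rewrite !addSn qnumSS -addSn IH2 IH1 !qnumSS; ring.
Qed.

(** The recursion reads the same backwards, and [m] = 0, [m-1] = 1 repeat the initial values [0],
    [1] from the other end. *)
Lemma qnum_compl m j : (0 < m)%N -> q m = 0 -> q m.-1 = 1 -> (j <= m)%N ->
  q (m - j) = q j.
Proof.
move=> m0 qm qm1; suff H : forall i, ((i <= m)%N -> q (m - i) = q i) /\
    ((i.+1 <= m)%N -> q (m - i.+1) = q i.+1) by apply: (H j).1.
elim=> [|i [IH1 IH2]]; first by rewrite subn0 subn1 qm qm1.
split=> // le_im; have := qnumSS (m - i.+2).
have -> : (m - i.+2).+2 = (m - i)%N by lia.
have -> : (m - i.+2).+1 = (m - i.+1)%N by lia.
rewrite IH1 ?IH2; [|lia..].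
by move=> E; rewrite qnumSS E; ring.
Qed.

(** The quantum factorial [j]!. *)
Definition qfact j := \prod_(i < j) q i.+1.

Lemma qfactS j : qfact j.+1 = qfact j * q j.+1.
Proof. by rewrite /qfact big_ord_recr. Qed.

(** The quantum binomial coefficients of m-1 are all 1: by [m-i] = [i] the factors above [j] are
    those of [m-1-j]! in reverse order. *)
Lemma qfact_compl m j : (0 < m)%N -> q m = 0 -> q m.-1 = 1 -> (j < m)%N ->
  qfact m.-1 = qfact j * qfact (m.-1 - j).
Proof.
move=> m0 qm qm1 ltjm; have -> : qfact m.-1 = qfact (j + (m.-1 - j)) by congr qfact; lia.
rewrite {1}/qfact big_split_ord; congr (_ * _); rewrite /qfact /=.
rewrite (reindex_inj rev_ord_inj) /=; apply: eq_bigr => i _.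
have := ltn_ord i => lti; rewrite -[RHS](qnum_compl m0 qm qm1); last lia.
by congr (qnum a _); rewrite /=; lia.
Qed.

End QuantumNumbers.

(** * Words in two Demazure operators *)

Section DemazurePair.
Variables (k : comNzRingType) (n : nat) (a : k) (c r : bool -> 'rV[k]_n).
Hypothesis cr : forall b, pairing (c b) (r b) = 2.
Hypothesis crN : forall b, pairing (c b) (r (~~ b)) = - a.

Local Notation q := (qnum a).
Local Notation w := (alt (fun b => refl_hs (c b) (r b))).
Implicit Types (phi psi : 'rV[k]_n).

Let crN' b : pairing (c (~~ b)) (r b) = - a.
Proof. by rewrite -{2}(negbK b) crN. Qed.

Lemma reflWSr b j phi :
  w b j.+1 phi =
    w b j phi - pairing (c (b (+) odd j)) (w b j phi) *: r (b (+) odd j).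
Proof. exact: altSr. Qed.

(** Call the left side x_j. A reflection negates the pairing with its own coroot, which gives
    x_{j+2} = a x_{j+1} - x_j, the recursion of the quantum numbers. *)
Lemma word_pairing b j phi :
  pairing (c (b (+) odd j)) (w b j phi) =
    q j.+1 * pairing (c b) phi + q j * pairing (c (~~ b)) phi.
Proof.
suff: pairing (c (b (+) odd j)) (w b j phi) =
        q j.+1 * pairing (c b) phi + q j * pairing (c (~~ b)) phi /\
      pairing (c (b (+) odd j.+1)) (w b j.+1 phi) =
        q j.+2 * pairing (c b) phi + q j.+1 * pairing (c (~~ b)) phi by case.
elim: j => [|j [IH1 IH2]].
  rewrite addbF addbT reflWSr addbF /alt /= pairingD pairingN pairingZ.
  by rewrite crN' !qnumSS qnum1 qnum0; split; ring.
split=> //; rewrite reflWSr pairingD pairingN pairingZ IH2.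
rewrite reflWSr pairingD pairingN pairingZ.
have -> : b (+) odd j.+2 = b (+) odd j by rewrite /= negbK.
rewrite IH1 cr /= addbN crN.
by rewrite (qnumSS _ j.+1) (qnumSS _ j); ring.
Qed.

(** At [j = m] the factor [m] = 0 makes the two words agree on linear forms. *)
Lemma word_diff b j phi :
  w b j phi - w (~~ b) j phi =
    q j *: (pairing (c (~~ b)) phi *: r (b (+) odd j)
            - pairing (c b) phi *: r (~~ b (+) odd j)).
Proof.
set A := pairing (c b) _; set B := pairing (c (~~ b)) _.
elim: j => [|j IH]; first by rewrite subrr scale0r.
rewrite !reflWSr !word_pairing negbK -/A -/B.
have -> : forall u v y z : 'rV[k]_n, u - v - (y - z) = (u - y) - v + z.
  by move=> u v y z; rewrite opprB addrACA -!addrA; congr (_ + _);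
     rewrite addrCA [RHS]addrC -addrA.
rewrite IH; apply/rowP => i.
have -> : b (+) odd j.+1 = ~~ b (+) odd j by rewrite /= addbN addNb.
have -> : ~~ b (+) odd j.+1 = b (+) odd j by exact: addbNN.
by rewrite !mxE; ring.
Qed.

Lemma word_root b j :
  w (~~ b) j (r b) = q j.+1 *: r (b (+) odd j) + q j *: r (~~ b (+) odd j).
Proof.
elim: j => [|j IH]; first by rewrite qnum0 qnum1 scale1r scale0r addr0 addbF.
rewrite reflWSr word_pairing negbK cr crN' IH.
have -> : b (+) odd j.+1 = ~~ b (+) odd j by rewrite /= addbN addNb.
have -> : ~~ b (+) odd j.+1 = b (+) odd j by exact: addbNN.
by apply/rowP => i; rewrite !mxE qnumSS; ring.
Qed.

(** * Words of twisted derivations on a ring generated by linear forms *)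

Section Words.
Variables (R : comNzRingType) (kap : {rmorphism k -> R}).
Variables (lin : 'rV[k]_n -> R) (s d : bool -> R -> R).
Hypothesis linD : forall phi psi, lin (phi + psi) = lin phi + lin psi.
Hypothesis linZ : forall x phi, lin (x *: phi) = kap x * lin phi.
Hypothesis gen : forall Q : R -> Prop, Q 1 -> (forall x f, Q f -> Q (kap x * f)) ->
  (forall f g, Q f -> Q g -> Q (f + g)) -> (forall phi f, Q f -> Q (lin phi * f)) ->
  forall f, Q f.
Hypothesis sM : forall b f g, s b (f * g) = s b f * s b g.
Hypothesis s_lin : forall b phi, s b (lin phi) = lin (refl_hs (c b) (r b) phi).
Hypothesis sK : forall b f, s b (s b f) = f.
Hypothesis dD : forall b f g, d b (f + g) = d b f + d b g.
Hypothesis dM : forall b f g, d b (f * g) = d b f * g + s b f * d b g.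
Hypothesis d_kap : forall b x, d b (kap x) = 0.
Hypothesis d_lin : forall b phi, d b (lin phi) = kap (pairing (c b) phi).
Hypothesis dK : forall b f, d b (d b f) = 0.
Hypothesis d_inv : forall b f, d b f = 0 <-> s b f = f.
Implicit Types (f g h : R).

Local Notation F := (alt d).

Lemma ddiff0 b : d b 0 = 0. Proof. by have := d_kap b 0; rewrite rmorph0. Qed.
Lemma ddiff1 b : d b 1 = 0. Proof. by rewrite -(rmorph1 kap) d_kap. Qed.

Lemma ddiffMl b f g : d b f = 0 -> d b (f * g) = f * d b g.
Proof. by move=> f0; rewrite dM f0 mul0r add0r; move/d_inv: f0 => ->. Qed.

Lemma ddiffMr b f g : d b g = 0 -> d b (f * g) = d b f * g.
Proof. by move=> g0; rewrite mulrC ddiffMl // mulrC. Qed.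

Lemma ddiff_kapM b (x : k) f : d b (kap x * f) = kap x * d b f.
Proof. by rewrite ddiffMl. Qed.

Lemma ddiffB b f g : d b (f - g) = d b f - d b g.
Proof. by rewrite dD -mulN1r ddiffMl ?mulN1r // -(rmorphN1 kap) d_kap. Qed.

Lemma demW0 b j : F b j 0 = 0.
Proof. by elim: j => [//|j IH]; rewrite altSr IH ddiff0. Qed.

Lemma demWS1 b j : F b j.+1 1 = 0.
Proof. by rewrite altSl ddiff1 demW0. Qed.

Lemma demWD b j f g : F b j (f + g) = F b j f + F b j g.
Proof. by elim: j => [//|j IH]; rewrite !altSr IH dD. Qed.

Lemma demWB b j f g : F b j (f - g) = F b j f - F b j g.
Proof. by elim: j => [//|j IH]; rewrite !altSr IH ddiffB. Qed.

Lemma demWM b j f g : (forall e, d e f = 0) -> F b j (f * g) = f * F b j g.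
Proof. by move=> f0; elim: j => [//|j IH]; rewrite !altSr IH ddiffMl. Qed.

Lemma demW_sum b j N (f : 'I_N -> R) : F b j (\sum_i f i) = \sum_i F b j (f i).
Proof. by apply: (big_morph _ (demWD b j) (demW0 b j)). Qed.

(* Omitting an inner letter of the word leaves two equal neighbours, so that
   only the first and the last letter contribute. *)
Lemma word_leibniz b j phi f :
  F b j.+2 (lin phi * f) = lin (w b j.+2 phi) * F b j.+2 f
    + kap (pairing (c b) phi) * F (~~ b) j.+1 f
    + kap (pairing (c (b (+) odd j.+1)) (w b j.+1 phi)) * F b j.+1 f.
Proof.
have step e psi g : d e (lin psi * g) =
    kap (pairing (c e) psi) * g + lin (refl_hs (c e) (r e) psi) * d e g.
  by rewrite dM d_lin s_lin.
elim: j => [|j IH].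
  by rewrite /alt /= addbT step dD ddiff_kapM step; ring.
rewrite altSr IH !dD !ddiff_kapM step.
have -> : d (b (+) odd j.+2) (F b j.+1 f) = 0 by rewrite altSr /= negbK dK.
rewrite [F b j.+3 f]altSr [w b j.+3 phi]altSr.
have <- : F (~~ b) j.+2 f = d (b (+) odd j.+2) (F (~~ b) j.+1 f).
  by rewrite altSr /= addbNN negbK.
by ring.
Qed.

(** * The braid relation and adjunction for the trace form *)

Section Braid.
Variable m : nat.
Hypothesis m_gt1 : (1 < m)%N.
Hypothesis qm : q m = 0.
Hypothesis qm1 : q m.-1 = 1.

(* The two leftover terms of [word_leibniz] get swapped by [b |-> ~~ b]
   because [m-1] = 1, so the difference of both sides is linear over [lin phi]
   up to the twist by the longest element. *)
Lemma braid b f : F b m f = F (~~ b) m f.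
Proof.
case: m m_gt1 qm qm1 => [|[|j]] //= _ q0 q1.
elim/gen: f => [|x f IH|f g IHf IHg|phi f IH].
- by rewrite !demWS1.
- by rewrite !demWM ?IH // => e.
- by rewrite !demWD IHf IHg.
- have /subr0_eq E : w b j.+2 phi - w (~~ b) j.+2 phi = 0.
    by rewrite word_diff q0 scale0r.
  rewrite !word_leibniz !word_pairing IH E negbK q0 q1 !mul0r !add0r !mul1r.
  by ring.
Qed.

Lemma braid_any b e f : F b m f = F e m f.
Proof. by case: b e => [] [] //; rewrite braid. Qed.

(** The trace from the invariants of [s b] to the common invariants: its word continues [d b] to the
    full word of length [m]. *)
Definition tr b f := F (~~ b) m.-1 f.

Lemma tr_d b f : tr b (d b f) = F b m f.
Proof. by rewrite /tr -altSl prednK // ltnW. Qed.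

(** One operator repeats the last letter of the word and squares to zero, or kills [f] itself if the
    word is empty. The other one prolongs the word to length [j.+1]. *)
Lemma word_inv b j f : d (~~ b) f = 0 -> F b j.+1 f = 0 -> forall e, d e (F b j f) = 0.
Proof.
move=> f0 Ff e; have [->|ne] := eqVneq e (b (+) odd j); first by rewrite -altSr.
have {ne} -> : e = ~~ b (+) odd j by case: (e) (b) (odd j) ne => [] [] [].
case: j {Ff} => [|j]; first by rewrite addbF.
by rewrite altSr /= addNb addbN negbK dK.
Qed.

Lemma word_m0 b f : d b f = 0 -> F (~~ b) m f = 0.
Proof. by move=> f0; rewrite (braid_any _ b) -tr_d f0 /tr demW0. Qed.

Lemma tr_inv b f : d b f = 0 -> forall e, d e (tr b f) = 0.
Proof.
move=> f0; apply: word_inv; first by rewrite negbK.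
by rewrite prednK ?word_m0 // ltnW.
Qed.

(** By the braid relation the word of length [m] may start with [d e]; then both sides are
    [tr e (d e f * d e h)]. *)
Lemma dm_adj e b f h : F b m (d e f * h) = F b m (f * d e h).
Proof. by rewrite !(braid_any b e) -!tr_d ddiffMl // ddiffMr. Qed.

(** Letters cross the product one at a time, which reverses the word: its first letter on the right
    is its last one on the left. *)
Lemma word_adj e b j f h :
  F e m (F b j f * h) = F e m (f * F (b (+) odd j.+1) j h).
Proof.
elim: j h => [//|j IH] h; rewrite altSr dm_adj IH altSl; congr (F e m (f * _)).
by rewrite /= negbK addbN.
Qed.

(** * Fundamental weights and a basis of the invariants of one reflection *)

Variable om : bool -> 'rV[k]_n.
Hypothesis c_om : forall b, pairing (c b) (om b) = 1.
Hypothesis cN_om : forall b, pairing (c (~~ b)) (om b) = 0.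

Local Notation v b j := (w b j (om b)).

Lemma arc_pairing b j : pairing (c (b (+) odd j)) (v b j) = q j.+1.
Proof. by rewrite word_pairing c_om cN_om; ring. Qed.

Lemma lin_arcS b j : lin (v b j.+1) = s (b (+) odd j) (lin (v b j)).
Proof. by rewrite s_lin altSr. Qed.

Lemma d_lin_om b : d (~~ b) (lin (om b)) = 0.
Proof. by rewrite d_lin cN_om rmorph0. Qed.

Definition arc b l := \prod_(i < l) lin (v b i).

Lemma arcS b l : arc b l.+1 = arc b l * lin (v b l).
Proof. by rewrite /arc big_ord_recr. Qed.

(** The reflection [s (b (+) odd l)] fixes [arc b l] by induction and exchanges the next two
    factors, so it fixes [arc b l.+2]. *)
Lemma arc_inv b l : d (b (+) odd l) (arc b l) = 0.
Proof.
suff: d (b (+) odd l) (arc b l) = 0 /\ d (b (+) odd l.+1) (arc b l.+1) = 0 by case.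
elim: l => [|l [IH1 IH2]].
  by rewrite arcS /arc big_ord0 ddiff1 mul1r addbT d_lin_om.
split=> //; have -> : b (+) odd l.+2 = b (+) odd l by rewrite /= negbK.
apply/d_inv; rewrite !arcS lin_arcS !sM sK; move/d_inv: IH1 => ->.
by rewrite mulrAC.
Qed.

(** Each letter leaves all factors but the last alone and turns the last one, of index l, into
    [l+1]. *)
Lemma word_arc b l : F (~~ b (+) odd l) l (arc b l) = kap (qfact a l).
Proof.
elim: l => [|l IH]; first by rewrite /arc /qfact !big_ord0 rmorph1.
rewrite altSl; have -> : ~~ b (+) odd l.+1 = b (+) odd l by exact: addbNN.
rewrite arcS ddiffMl ?arc_inv // d_lin arc_pairing mulrC -addNb demWM //.
by rewrite IH mulrC qfactS rmorphM.
Qed.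

Variable u : k.
Hypothesis qfactK : u * qfact a m.-1 = 1.

(** [arc true m.-1] is killed by [d (odd m)]. A word starting with that operator therefore consumes
    the extra factor [lin (om (odd m))] first, with value 1, and then strips the arc; [u] cancels
    the resulting [m-1]!. *)
Definition top := kap u * (lin (om (odd m)) * arc true m.-1).

Lemma word_top b : F b m top = 1.
Proof.
have E : true (+) odd m.-1 = odd m by case: (m) m_gt1.
rewrite (braid_any _ (odd m)) -tr_d /top ddiff_kapM ddiffMr -?E ?arc_inv //.
rewrite d_lin c_om rmorph1 mul1r /tr demWM //.
by have := word_arc true m.-1; rewrite addNb E => ->; rewrite -rmorphM qfactK rmorph1.
Qed.

(** The first letter is chosen so that, for [l < m], the last one is [d b]; the index [l] is the
    degree. Continuing with [F (~~ b) l] completes a word of length [m]. *)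
Definition arc_basis b l := F (~~ b (+) odd (m - l)) (m - l) top.
Local Notation e := arc_basis.

Lemma arc_basisE b l : (l < m)%N ->
  e b l = d b (F (~~ b (+) odd (m - l)) (m.-1 - l) top).
Proof.
move=> lm; rewrite /e; have -> : (m - l = (m.-1 - l).+1)%N by lia.
by rewrite altSr /= addbNN -addbA addbb addbF.
Qed.

Lemma arc_basis_inv b l : (l < m)%N -> d b (e b l) = 0.
Proof. by move=> lm; rewrite arc_basisE. Qed.

Lemma word_arc_basis b l : (l <= m)%N -> F (~~ b) l (e b l) = 1.
Proof.
move=> lm; transitivity (F (~~ b (+) odd (m - l)) (m - l + l) top).
  by rewrite altD -addbA addbb addbF.
by rewrite subnK // word_top.
Qed.

Lemma word_arc_basis_gt b l j : (l <= m)%N -> (l < j)%N -> F (~~ b) j (e b l) = 0.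
Proof.
move=> lm lj; have -> : (j = l + (j - l.+1).+1)%N by lia.
by rewrite altD word_arc_basis // demWS1.
Qed.

(** The last letter [d b] of [e b i] is absorbed by the trace into the full word, and adjunction
    moves the other letters from [top] to [h]. *)
Lemma tr_arc_basis b i h : (i < m)%N -> d b h = 0 ->
  tr b (e b i * h) = F b m (top * F (~~ b) (m.-1 - i) h).
Proof.
move=> im h0; rewrite arc_basisE // -ddiffMr // tr_d word_adj.
congr (F b m (top * F _ _ h)); have -> : (m - i = (m.-1 - i).+1)%N by lia.
by rewrite -addbA addbb addbF.
Qed.

Lemma tr_arc_basis_eq b i : (i < m)%N -> tr b (e b i * e b (m.-1 - i)) = 1.
Proof.
move=> im; rewrite tr_arc_basis ?arc_basis_inv //; last lia.
by rewrite word_arc_basis ?mulr1 ?word_top //; lia.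
Qed.

Lemma tr_arc_basis_lt b i j : (i + j < m.-1)%N -> tr b (e b i * e b j) = 0.
Proof.
move=> ij; rewrite tr_arc_basis ?arc_basis_inv //; try lia.
by rewrite word_arc_basis_gt ?mulr0 ?demW0 //; lia.
Qed.

(* The remaining coefficient [F (~~ b) l f] is killed by both operators. *)
Lemma arc_basis_span b l f : (l <= m)%N -> d b f = 0 -> F (~~ b) l f = 0 ->
  exists x : nat -> R, (forall i e', d e' (x i) = 0) /\ f = \sum_(i < l) x i * e b i.
Proof.
elim: l f => [|l IH] f lm f0 Ff.
  by exists (fun=> 0); split=> [i b'|]; rewrite ?ddiff0 // big_ord0.
have gW : forall b', d b' (F (~~ b) l f) = 0 by apply: word_inv; rewrite ?negbK.
have [||| x [xW Ex]] := IH (f - F (~~ b) l f * e b l).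
- exact: ltnW.
- by rewrite ddiffB f0 ddiffMl // arc_basis_inv // mulr0 subr0.
- by rewrite demWB demWM // word_arc_basis ?mulr1 ?subrr // ltnW.
exists (fun i => if i == l then F (~~ b) l f else x i); split=> [i b'|].
  by case: ifP.
rewrite big_ord_recr /= eqxx -[LHS](subrK (F (~~ b) l f * e b l)) Ex.
by congr (_ + _); apply: eq_bigr => i _; rewrite ltn_eqF.
Qed.

(** * Homogeneity and dual bases *)

Variable hom : nat -> R -> Prop.
Hypothesis hom0 : forall i, hom i 0.
Hypothesis homB : forall i f g, hom i f -> hom i g -> hom i (f - g).
Hypothesis homM : forall i j f g, hom i f -> hom j g -> hom (i + j)%N (f * g).
Hypothesis hom_kap : forall x, hom 0 (kap x).
Hypothesis hom_lin : forall phi, hom 1 (lin phi).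
Hypothesis hom_d : forall b i f, hom i.+1 f -> hom i (d b f).

Let homD i f g : hom i f -> hom i g -> hom i (f + g).
Proof. by move=> hf hg; rewrite -[g]opprK -[- g]sub0r; do 2?apply: homB. Qed.

Let hom_sum N i (f : 'I_N -> R) : (forall j, hom i (f j)) -> hom i (\sum_j f j).
Proof. by move=> hf; apply: (big_ind (hom i)) => //; apply: homD. Qed.

Lemma hom_word b i j f : hom (j + i)%N f -> hom i (F b j f).
Proof.
elim: j i => [//|j IH] i hf; rewrite altSr; apply/hom_d/IH.
by rewrite addnS -addSn.
Qed.

Lemma hom_top : hom m top.
Proof.
rewrite /top -[m]add0n; apply: homM; first exact: hom_kap.
rewrite -(prednK (ltnW m_gt1)) -add1n; apply: homM; first exact: hom_lin.
elim: m.-1 => [|l IH]; first by rewrite /arc big_ord0 -(rmorph1 kap); apply: hom_kap.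
by rewrite arcS -addn1; apply: homM.
Qed.

Lemma hom_arc_basis b l : (l <= m)%N -> hom l (e b l).
Proof. by move=> lm; apply: hom_word; rewrite subnK //; apply: hom_top. Qed.

(* Gram-Schmidt: the Gram matrix of [arc_basis] is antitriangular. *)
Lemma arc_dual b l : (l <= m)%N -> exists g : nat -> R, forall j, (j < l)%N ->
  [/\ d b (g j) = 0, hom j (g j),
      forall i, (i < m)%N -> tr b (e b (m.-1 - i) * g j) = (i == j)%:R &
      e b j = \sum_(i < j.+1) tr b (e b (m.-1 - i) * e b j) * g i].
Proof.
elim: l => [_|l IH lm]; first by exists (fun=> 0).
have [g Hg] := IH (ltnW lm).
pose t i := tr b (e b (m.-1 - i) * e b l).
have tW i b' : d b' (t i) = 0.
  by apply: tr_inv; rewrite ddiffMl !arc_basis_inv ?mulr0 //; lia.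
(* The earlier [g i] are dual to the [e b (m.-1 - i)], so this removes the components of [e b l]
   along them; antitriangularity gives the remaining pairings, with [t l = 1]. *)
pose gl := e b l - \sum_(i < l) t i * g i.
exists (fun j => if j == l then gl else g j) => j.
rewrite ltnS leq_eqVlt => /orP[/eqP->|jl]; last first.
  have [g0 hg tg Eg] := Hg j jl; rewrite (ltn_eqF jl); split=> //.
  rewrite {1}Eg; apply: eq_bigr => i _; rewrite ltn_eqF //.
  by rewrite (leq_ltn_trans _ jl) // -ltnS.
rewrite eqxx; split.
- rewrite ddiffB arc_basis_inv // sub0r (big_morph _ (dD b) (ddiff0 b)) big1 ?oppr0 // => i _.
  by rewrite ddiffMl //; have [-> //] := Hg i (ltn_ord i); rewrite mulr0.
- apply: homB; first exact/hom_arc_basis/ltnW.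
  apply: hom_sum => i; have [_ hg _ _] := Hg i (ltn_ord i).
  have : hom (l - i + i)%N (t i * g i); last by rewrite subnK // ltnW.
  apply: homM => //; apply: hom_word.
  have -> : (m.-1 + (l - i) = (m.-1 - i) + l)%N by have := ltn_ord i; lia.
  by apply: homM; apply: hom_arc_basis; lia.
- move=> i im; rewrite /gl mulrBr /tr demWB -/(tr b _) mulr_sumr demW_sum.
  have -> : \sum_(i0 < l) F (~~ b) m.-1 (e b (m.-1 - i) * (t i0 * g i0)) =
            \sum_(i0 < l) t i0 * (i == i0)%:R.
    apply: eq_bigr => j0 _; rewrite mulrCA demWM // -/(tr b _).
    by have [_ _ -> //] := Hg j0 (ltn_ord j0).
  case: (ltngtP i l) => [il|li|->].
  + rewrite (bigD1 (Ordinal il)) //= eqxx mulr1 big1 ?addr0 ?subrr // => j0 ne.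
    by move: ne; rewrite -val_eqE /= eq_sym => /negPf->; rewrite mulr0.
  + rewrite tr_arc_basis_lt; last lia.
    by rewrite big1 ?subr0 // => j0 _; rewrite gtn_eqF ?mulr0 // (ltn_trans _ li).
  + rewrite big1 ?subr0 => [|j0 _]; last by rewrite gtn_eqF ?mulr0.
    by have := @tr_arc_basis_eq b (m.-1 - l); rewrite subKn; [apply; lia | lia].
- rewrite big_ord_recr /= eqxx -/(t l).
  have -> : t l = 1.
    by have := @tr_arc_basis_eq b (m.-1 - l); rewrite subKn; [apply; lia | lia].
  rewrite mul1r /gl addrC -[LHS](subrK (\sum_(i < l) t i * g i)); congr (_ + _).
  by apply: eq_bigr => i _; rewrite ltn_eqF.
Qed.

Lemma arc_frobenius b : exists x y : 'I_m -> R,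
  [/\ forall i, d b (x i) = 0 /\ hom i (x i),
      forall i, d b (y i) = 0 /\ hom (m.-1 - i)%N (y i),
      forall f, d b f = 0 -> exists z : 'I_m -> R,
        (forall i e', d e' (z i) = 0) /\ f = \sum_i z i * x i,
      forall f, d b f = 0 -> exists z : 'I_m -> R,
        (forall i e', d e' (z i) = 0) /\ f = \sum_i z i * y i &
      forall i j, tr b (x i * y j) = (i == j)%:R].
Proof.
have [g Hg] := arc_dual b (leqnn m).
pose t i j := tr b (e b (m.-1 - i) * e b j).
have tW i j b' : (j < m)%N -> d b' (t i j) = 0.
  by move=> jm; apply: tr_inv; rewrite ddiffMl !arc_basis_inv ?mulr0 //; lia.
have subm (i : 'I_m) : (m.-1 - i = rev_ord i)%N by rewrite /=; lia.
have span_e f : d b f = 0 -> exists z : 'I_m -> R,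
    (forall i e', d e' (z i) = 0) /\ f = \sum_i z i * e b i.
  move=> f0; have [z [zW Ef]] := arc_basis_span (leqnn m) f0 (word_m0 f0).
  by exists (fun i => z i); split=> // i.
(* [g j] pairs to 1 with [e b (m.-1 - j)], so the dual of [e b i] is [g] at the reversed index,
   which is also its degree. *)
exists (fun i => e b i), (fun i => g (m.-1 - i)%N); split.
- by move=> i; rewrite arc_basis_inv //; split=> //; apply/hom_arc_basis/ltnW.
- by move=> i; rewrite subm; have [] := Hg _ (ltn_ord (rev_ord i)).
- exact: span_e.
- move=> f /span_e[z [zW ->]].
  exists (fun i => \sum_j z j * t (rev_ord i) j); split.
    move=> i e'; rewrite (big_morph _ (dD e') (ddiff0 e')) big1 // => j _.
    by rewrite ddiffMl ?tW ?mulr0.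
  have e_g (j : 'I_m) : e b j = \sum_(i < m) t i j * g i.
    have [_ _ _ ->] := Hg j (ltn_ord j).
    rewrite (big_ord_widen _ (fun i => t i j * g i) (ltn_ord j)) big_mkcond.
    apply: eq_bigr => i _ /=; case: ltnP => // ji.
    by rewrite /t tr_arc_basis_lt ?mul0r //; have := ltn_ord i; lia.
  under eq_bigr => j _ do rewrite e_g mulr_sumr.
  rewrite exchange_big (reindex_inj rev_ord_inj); apply: eq_bigr => i _ /=.
  rewrite subm mulr_suml; apply: eq_bigr => j _.
  by rewrite mulrA.
- move=> i j; have [_ _ H _] := Hg (m.-1 - j)%N ltac:(have := ltn_ord j; lia).
  have := H (m.-1 - i)%N ltac:(have := ltn_ord i; lia).
  have -> : (m.-1 - (m.-1 - i) = i)%N by have := ltn_ord i; lia.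
  move=> ->; congr (_%:R); rewrite -val_eqE /=; congr nat_of_bool.
  by apply/eqP/eqP => [|->] //; have := ltn_ord i; have := ltn_ord j; lia.
Qed.

(** * The product of the positive roots *)

Lemma word_om_mul b j f : d (~~ b) f = 0 ->
  F b j.+1 (lin (om b) * f) = lin (v b j.+1) * F b j.+1 f + kap (q j.+1) * F b j f.
Proof.
move=> f0; have <- := arc_pairing b j; case: j => [|j].
  by rewrite addbF /alt /= dM d_lin s_lin; ring.
(* One correction term begins with [d (~~ b)], which kills [f]. *)
rewrite word_leibniz [F (~~ b) _ _]altSl f0 demW0.
by ring.
Qed.

(** If [b] stands for s, this is the root $f_{s,l}$. *)
Definition rho b l := lin (w (~~ b) l (r b)).

Lemma linN phi : lin (- phi) = - lin phi.
Proof. by rewrite -scaleN1r linZ rmorphN1 mulN1r. Qed.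

(** The difference for index j is the sum of [i+1] times alternating simple roots over i < j.
    Quantum numbers of odd index up to 2c+1 add up to [c+1]^2 and those of even index up to 2c to
    [c][c+1], whence a common factor [c+1] and a root; the other parity is similar. *)
Lemma lin_arc_diff b c0 :
  lin (om (~~ b)) - lin (v (~~ b) c0.*2.+1) =
    kap (q c0.+1) * rho (~~ b (+) odd c0) c0 /\
  lin (om (~~ b)) - lin (v (~~ b) c0.+1.*2) =
    kap (q c0.+1) * rho (b (+) odd c0.+1) c0.+1.
Proof.
have dv j : lin (om (~~ b)) - lin (v (~~ b) j.+1) = lin (om (~~ b)) - lin (v (~~ b) j)
    + kap (q j.+1) * lin (r (~~ b (+) odd j)).
  by rewrite reflWSr arc_pairing linD linN linZ; ring.
have rhoE e i : rho (e (+) odd i) i =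
    kap (q i.+1) * lin (r e) + kap (q i) * lin (r (~~ e)).
  rewrite /rho word_root linD !linZ -addbA addbb addbF.
  by rewrite -addNb -addbA addbb addbF.
have qodd i : q i.*2.+1 = q i.+1 ^+ 2 - q i ^+ 2.
  by rewrite -addnn qnum_add !expr2.
have qeven i : q i.*2.+2 = q i.+1 * (q i.+2 - q i).
  by rewrite -addnn -addSn qnum_add; ring.
elim: c0 => [|i [_ IH]].
  rewrite !dv rhoE rhoE /alt /= addbF addbT negbK qnumSS qnum1 qnum0.
  by split; ring.
have E : lin (om (~~ b)) - lin (v (~~ b) i.+1.*2.+1) =
    kap (q i.+2) * rho (~~ b (+) odd i.+1) i.+1.
  by rewrite dv IH !rhoE odd_double addbF qodd negbK; ring.
split=> //; rewrite [i.+2.*2]doubleS dv E !rhoE [odd _]/= odd_double addbT negbK.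
by rewrite qeven (qnumSS a i.+1); ring.
Qed.

(** For odd [m] the identity [m-i] = [i] shows that both types of roots give the same list, in
    opposite orders. *)
Lemma rho_compl b (h l : nat) : m = h.*2.+1 -> (l <= h.*2)%N -> rho b (h.*2 - l) = rho (~~ b) l.
Proof.
move=> mh lh; have cq i : (i <= m)%N -> q (m - i) = q i.
  exact: (qnum_compl (ltnW m_gt1) qm qm1).
rewrite /rho !word_root negbK.
have -> : odd (h.*2 - l) = odd l by rewrite oddB // odd_double.
have -> : (h.*2 - l).+1 = (m - l)%N by lia.
have -> : (h.*2 - l)%N = (m - l.+1)%N by lia.
by rewrite !cq; [rewrite addrC|lia|lia].
Qed.

Definition pos_roots b :=
  if ~~ odd m then \prod_(l < m./2) (rho b l * rho (~~ b) l)
  else \prod_(l < m) rho b l.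

(** Together with the simple root in front, the roots of equal index pair up. The scalars accumulate
    to [h]! [h+1]! for even [m] and to [h]! [h]! for odd [m], in both cases [m-1]! by
    [qfact_compl]. *)
Lemma prod_arc_diff b :
  lin (r b) * \prod_(j < m.-1) (lin (om (~~ b)) - lin (v (~~ b) j.+1)) =
    kap (qfact a m.-1) * pos_roots b.
Proof.
have rhoM l : rho (b (+) odd l) l * rho (~~ b (+) odd l) l = rho b l * rho (~~ b) l.
  by case: (odd l); rewrite ?addbT ?addbF ?negbK // mulrC.
(* An even number of differences leaves one root of index [h] unpaired; the next difference supplies
   its partner. *)
have odd_len (h : nat) :
    lin (r b) * \prod_(j < h.*2) (lin (om (~~ b)) - lin (v (~~ b) j.+1)) =
    kap (qfact a h) ^+ 2 * (\prod_(l < h) (rho b l * rho (~~ b) l))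
      * rho (b (+) odd h) h.
  elim: h => [|h IH].
    by rewrite /qfact !big_ord0 rmorph1 addbF /rho /alt /=; ring.
  rewrite doubleS !big_ord_recr /= (lin_arc_diff b h).1.
  rewrite -[h.*2.+2]/(h.+1.*2) (lin_arc_diff b h).2 !mulrA IH qfactS rmorphM.
  by rewrite -(mulrA _ (rho b h)) -rhoM /=; ring.
have qc (h : nat) : (h < m)%N -> qfact a m.-1 = qfact a h * qfact a (m.-1 - h).
  exact: (qfact_compl (ltnW m_gt1) qm qm1).
have := odd_double_half m; rewrite /pos_roots; case: ifPn => om2 mE.
  have [h hE] : exists h : nat, m./2 = h.+1 by exists (m./2).-1; lia.
  rewrite hE; have m1 : m.-1 = h.*2.+1 by lia.
  rewrite (qc h) ?m1; last lia.
  rewrite big_ord_recr /= mulrA odd_len (lin_arc_diff b h).1.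
  have -> : (h.*2.+1 - h = h.+1)%N by lia.
  by rewrite big_ord_recr /= -[in RHS]rhoM qfactS !rmorphM; ring.
(* For odd [m], [rho_compl] turns the roots of the opposite type into those of type [b] with index
   above [h]; the middle root is common to both types. *)
have [h mh] : exists h : nat, m = h.*2.+1 by exists m./2; lia.
have m1 : m.-1 = h.*2 by lia.
rewrite (qc h) ?m1; last lia.
have -> : \prod_(l < m) rho b l = \prod_(l < (h + h).+1) rho b l by rewrite addnn -mh.
rewrite odd_len -addnn addnK rmorphM -mulrA -expr2; congr (_ * _).
rewrite -addnS big_split_ord big_ord_recl /= addn0 big_split /=.
rewrite -mulrA; congr (_ * _); rewrite mulrC; congr (_ * _).
  case: (boolP (odd h)) => _; rewrite ?addbF // addbT.
  by rewrite -(rho_compl _ mh); [congr rho|]; lia.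
rewrite [RHS](reindex_inj rev_ord_inj); apply: eq_bigr => l _ /=.
rewrite -(rho_compl _ mh); last by have := ltn_ord l; lia.
by congr (rho b _); rewrite /= /bump; have := ltn_ord l; lia.
Qed.

(** * The Euler element of a pair of dual families *)

Section Euler.
Variables (b : bool) (N : nat) (x y : 'I_N -> R).
Hypothesis y_inv : forall i, d b (y i) = 0.
Hypothesis xy_tr : \sum_i x i * tr b (y i) = 1.
Hypothesis xy_comm : forall z j, d b z = 0 ->
  \sum_i x i * F (~~ b) j (z * y i) = z * \sum_i x i * F (~~ b) j (y i).

(** Multiplying the steps for j < m-1 expresses [m-1]! M_0 as the product of the differences;
    [prod_arc_diff] produces the same scalar, and [u] cancels it. *)
Lemma euler_elem : lin (r b) * (\sum_i x i * y i) = pos_roots b.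
Proof.
pose M j := \sum_i x i * F (~~ b) j (y i).
have om0 : d b (lin (om (~~ b))) = 0 by rewrite d_lin -{1}(negbK b) cN_om rmorph0.
have step j : kap (q j.+1) * M j = (lin (om (~~ b)) - lin (v (~~ b) j.+1)) * M j.+1.
  rewrite mulrBl -(xy_comm _ om0) !mulr_sumr -sumrB; apply: eq_bigr => i _.
  by rewrite word_om_mul ?negbK //; ring.
have prodM l : kap (qfact a l) * M 0 =
    \prod_(j < l) (lin (om (~~ b)) - lin (v (~~ b) j.+1)) * M l.
  elim: l => [|l IH]; first by rewrite /qfact !big_ord0 rmorph1.
  by rewrite qfactS big_ord_recr rmorphM /= -[RHS]mulrA -step [RHS]mulrCA -IH; ring.
have M1 : M m.-1 = 1 by [].
have /(congr1 ( *%R (kap u * lin (r b)))) := prodM m.-1.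
rewrite M1 mulr1 -![in RHS]mulrA prod_arc_diff !mulrA -rmorphM qfactK rmorph1 mul1r.
by rewrite [kap u * _ * _]mulrAC -rmorphM qfactK rmorph1 mul1r.
Qed.

End Euler.

End Braid.
End Words.
End DemazurePair.

(** * Frobenius extensions of invariant rings *)

Section FrobeniusExtension.
Variables (k : comNzRingType) (n : nat).
Local Notation R := {mpoly k[n]}.
Implicit Types (A B : pred R) (f g h : R).

Record subring_pair A B : Prop := SubringPair {
  subring_pairA : subring_closed A;
  subring_pairB : subring_closed B;
  subring_pairS : {subset A <= B} }.

Definition linear_trace A B (tr : R -> R) : Prop :=
  (forall f, f \in B -> tr f \in A) /\
  (forall a f g, a \in A -> f \in B -> g \in B ->
      tr (a * f + g) = a * tr f + tr g).

Definition spans A B N (b : 'I_N -> R) : Prop :=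
  forall f, f \in B -> exists c : 'I_N -> R,
      (forall i, c i \in A) /\ f = \sum_(i < N) c i * b i.

Section Extension.
Variables (A B : pred R) (tr : R -> R).
Hypothesis sAB : subring_pair A B.
Hypothesis trP : linear_trace A B tr.

Let AB : {subset A <= B} := subring_pairS sAB.

Lemma subring0 S : subring_closed S -> 0 \in (S : pred R).
Proof. by case=> S1 SB _; rewrite -(subrr 1) SB. Qed.

Lemma subringD S f g : subring_closed S -> f \in (S : pred R) -> g \in (S : pred R) ->
  f + g \in (S : pred R).
Proof.
move=> Sc fS gS; have [_ SB _] := Sc; rewrite -[g]opprK; apply: (SB) => //.
by rewrite -[- g]sub0r; apply: (SB) => //; apply: subring0.
Qed.

Lemma subringM S f g : subring_closed S -> f \in (S : pred R) -> g \in (S : pred R) ->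
  f * g \in (S : pred R).
Proof. by case=> _ _; apply. Qed.

Lemma subring_sum S N (f : 'I_N -> R) : subring_closed S ->
  (forall i, f i \in (S : pred R)) -> \sum_i f i \in (S : pred R).
Proof.
move=> Sc fS; apply: (big_ind (fun x => x \in (S : pred R))) => //.
  exact: subring0.
by move=> x y; apply: subringD.
Qed.

Let B0 : 0 \in B. Proof. exact: subring0 (subring_pairB sAB). Qed.
Let BM f g : f \in B -> g \in B -> f * g \in B.
Proof. exact: subringM (subring_pairB sAB). Qed.
Let A1 : 1 \in A. Proof. by case: (subring_pairA sAB). Qed.
Let A0 : 0 \in A. Proof. exact: subring0 (subring_pairA sAB). Qed.

Lemma trace0 : tr 0 = 0.
Proof.
have := trP.2 1 0 0 A1 B0 B0; rewrite mul1r addr0 mul1r => E.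
by apply: (addrI (tr 0)); rewrite addr0 -E.
Qed.

Lemma traceM a f : a \in A -> f \in B -> tr (a * f) = a * tr f.
Proof. by move=> aA fB; rewrite -[a * f]addr0 trP.2 // trace0 addr0. Qed.

Lemma traceD f g : f \in B -> g \in B -> tr (f + g) = tr f + tr g.
Proof. by move=> fB gB; rewrite -{1}[f]mul1r trP.2 // mul1r. Qed.

Lemma trace_sum N (c f : 'I_N -> R) : (forall i, c i \in A) -> (forall i, f i \in B) ->
  tr (\sum_i c i * f i) = \sum_i c i * tr (f i).
Proof.
move=> cA fB; suff [_ ->] : \sum_i c i * f i \in B /\
    tr (\sum_i c i * f i) = \sum_i c i * tr (f i) by [].
apply: (big_ind2 (fun x y => x \in B /\ tr x = y)).
- by split=> //; apply: trace0.
- move=> x1 x2 y1 y2 [xB <-] [yB <-]; rewrite traceD //; split=> //.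
  exact: subringD (subring_pairB sAB) _ _.
- by move=> i _; rewrite traceM //; split=> //; apply: BM => //; apply: AB.
Qed.

Lemma sum_delta N (c : 'I_N -> R) j : \sum_i c i * (i == j)%:R = c j.
Proof.
rewrite (bigD1 j) //= eqxx mulr1 big1 ?addr0 // => i /negPf->.
by rewrite mulr0.
Qed.

(** Uniqueness of coefficients is automatic: the trace against the dual family reads them off. *)
Lemma dual_bases_intro N (b b' : 'I_N -> R) :
  (forall i, b i \in B) -> (forall i, b' i \in B) -> spans A B b -> spans A B b' ->
  (forall i j, tr (b i * b' j) = (i == j)%:R) -> dual_bases A B tr b b'.
Proof.
move=> bB b'B sb sb' bb'.
have coef (x y : 'I_N -> R) (xB : forall i, x i \in B) (yB : forall i, y i \in B)
    (xy : forall i j, tr (x i * y j) = (i == j)%:R) c :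
    (forall i, c i \in A) -> forall j, tr ((\sum_i c i * x i) * y j) = c j.
  move=> cA j; rewrite mulr_suml.
  under eq_bigr => i _ do rewrite -mulrA.
  rewrite trace_sum // => [|i]; last exact: BM.
  by under eq_bigr => i _ do rewrite xy; rewrite sum_delta.
have bb'C i j : tr (b' i * b j) = (i == j)%:R by rewrite mulrC bb' eq_sym.
split; [split=> //; split=> // c c' cA c'A E i|split=> //; split=> //; split=> // c c' cA c'A E i].
  by rewrite -(coef _ _ bB b'B bb' c cA i) E coef.
by rewrite -(coef _ _ b'B bB bb'C c cA i) E coef.
Qed.

Lemma dual_bases_sym N (b b' : 'I_N -> R) :
  dual_bases A B tr b b' -> dual_bases A B tr b' b.
Proof.
by case=> hb [hb' E]; split=> //; split=> // i j; rewrite mulrC E eq_sym.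
Qed.

Lemma dual_expandl N (b b' : 'I_N -> R) f : dual_bases A B tr b b' -> f \in B ->
  f = \sum_i tr (f * b' i) * b i.
Proof.
move=> [[bB [sb _]] [[b'B _] E]] fB; have [c [cA Ef]] := sb f fB.
rewrite {1}Ef; apply: eq_bigr => j _; congr (_ * _).
rewrite Ef mulr_suml; under eq_bigr => i _ do rewrite -mulrA.
rewrite trace_sum // => [|i]; last exact: BM.
by under eq_bigr => i _ do rewrite E; rewrite sum_delta.
Qed.

Lemma dual_expandr N (b b' : 'I_N -> R) f : dual_bases A B tr b b' -> f \in B ->
  f = \sum_i tr (b i * f) * b' i.
Proof.
move/dual_bases_sym => D fB; rewrite {1}(dual_expandl D fB).
by apply: eq_bigr => i _; rewrite mulrC [f * _]mulrC mulrC.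
Qed.

Lemma dual_bases_mem N (b b' : 'I_N -> R) i : dual_bases A B tr b b' ->
  b i \in B /\ b' i \in B.
Proof. by case=> [[bB _] [[b'B _] _]]. Qed.

(** Expanding [b' i] in the family [c'] and exchanging the sums leaves coefficients that reassemble
    [c j] from the [b i]. *)
Lemma dual_prod_indep N (b b' : 'I_N -> R) M (c c' : 'I_M -> R) :
  dual_bases A B tr b b' -> dual_bases A B tr c c' ->
  \sum_i b i * b' i = \sum_j c j * c' j.
Proof.
move=> Db Dc; have bB i := (dual_bases_mem i Db); have cB i := (dual_bases_mem i Dc).
under eq_bigr => i _ do rewrite (dual_expandr Dc (bB i).2) mulr_sumr.
rewrite exchange_big; apply: eq_bigr => j _ /=.
rewrite {2}(dual_expandl Db (cB j).1) mulr_suml; apply: eq_bigr => i _.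
by rewrite mulrCA mulrA.
Qed.

Lemma trace_dual_prod N (b b' : 'I_N -> R) : dual_bases A B tr b b' ->
  tr (\sum_i b i * b' i) = N%:R.
Proof.
move=> D; have bB i := dual_bases_mem i D.
under eq_bigr => i _ do rewrite -[b i * b' i]mul1r.
rewrite trace_sum // => [|i]; last by apply: BM; case: (bB i).
under eq_bigr => i _ do rewrite D.2.2 eqxx mulr1.
by rewrite sumr_const card_ord.
Qed.

(* [(z (x) 1) Delta = (1 (x) z) Delta], pushed through [x (x) y |-> x * G y]. *)
Lemma dual_commute N (b b' : 'I_N -> R) (G : R -> R) z : dual_bases A B tr b b' ->
  (forall f g, G (f + g) = G f + G g) -> (forall a f, a \in A -> G (a * f) = a * G f) ->
  z \in B -> \sum_i b i * G (z * b' i) = z * \sum_i b i * G (b' i).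
Proof.
move=> D GD GM zB; have bB i := dual_bases_mem i D.
have G0 : G 0 = 0 by have := GM 0 0 A0; rewrite !mul0r.
have Gs M (f : 'I_M -> R) : G (\sum_i f i) = \sum_i G (f i).
  exact: (big_morph G GD G0).
have zb' i : z * b' i = \sum_j tr (z * b j * b' i) * b' j.
  rewrite {1}(dual_expandr D (BM zB (bB i).2)); apply: eq_bigr => j _.
  by rewrite mulrCA mulrA.
under eq_bigr => i _ do rewrite zb' Gs mulr_sumr.
rewrite exchange_big mulr_sumr; apply: eq_bigr => j _ /=.
rewrite mulrA (dual_expandl D (BM zB (bB j).1)) mulr_suml; apply: eq_bigr => i _.
have tA : tr (z * b j * b' i) \in A.
  by apply: trP.1; apply: BM (bB i).2; apply: BM => //; case: (bB j).
by rewrite -(dual_expandl D (BM zB (bB j).1)) GM // mulrCA mulrA.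
Qed.

Lemma graded_frobenius_intro N (b b' : 'I_N -> R) (d d' : 'I_N -> nat) :
  dual_bases A B tr b b' -> (forall i, b i \is (d i).-homog) ->
  (forall i, b' i \is (d' i).-homog) -> graded_frobenius A B tr.
Proof.
move=> [hb [hb' E]] db db'; split; first exact: trP.1.
by split; [exact: trP.2|exists N, b, b', d, d'].
Qed.

End Extension.

Lemma dual_bases_eq A B (tr tr' : R -> R) N (b b' : 'I_N -> R) :
  tr =1 tr' -> dual_bases A B tr b b' -> dual_bases A B tr' b b'.
Proof. by move=> E [? [? H]]; split=> //; split=> // i j; rewrite -E. Qed.

Lemma graded_frobenius_eq A B (tr tr' : R -> R) :
  tr =1 tr' -> graded_frobenius A B tr -> graded_frobenius A B tr'.
Proof.
move=> E [H1 [H2 [N [b [b' [d [d' [hb [hb' H]]]]]]]]].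
split=> [f fB|]; first by rewrite -E H1.
split=> [x f g xA fB gB|]; first by rewrite -!E H2.
by exists N, b, b', d, d'; split=> //; split=> // i j; rewrite -E.
Qed.

End FrobeniusExtension.

Lemma sum_map_enum (P : nmodType) (T : Type) N (F : 'I_N -> T) (G : T -> P) :
  \sum_(p <- [seq F i | i <- enum 'I_N]) G p = \sum_i G (F i).
Proof. by rewrite big_map big_enum. Qed.

(** * Balanced maps and equality in the tensor product *)

Section Tensor.
Variables (k : comNzRingType) (n : nat).
Local Notation R := {mpoly k[n]}.
Variables (A M N : pred R).
Implicit Types (xs ys zs : seq (R * R)).

Lemma tensor_eq_sym xs ys : tensor_eq A M N xs ys -> tensor_eq A M N ys xs.
Proof.
by move=> [hx [hy H]]; split=> //; split=> // P beta B1 B2 B3; rewrite (H P beta).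
Qed.

Lemma tensor_eq_trans xs ys zs :
  tensor_eq A M N xs ys -> tensor_eq A M N ys zs -> tensor_eq A M N xs zs.
Proof.
move=> [hx [_ H]] [_ [hz H']]; split=> //; split=> // P beta B1 B2 B3.
by rewrite (H P beta) // (H' P beta).
Qed.

Section Balanced.
Variables (P : zmodType) (beta : R -> R -> P).
Hypothesis betaDl : forall x x' y, x \in M -> x' \in M -> y \in N ->
  beta (x + x') y = beta x y + beta x' y.
Hypothesis betaDr : forall x y y', x \in M -> y \in N -> y' \in N ->
  beta x (y + y') = beta x y + beta x y'.
Hypothesis betaM : forall x y z, x \in A -> y \in M -> z \in N ->
  beta (x * y) z = beta y (x * z).
Hypothesis sAM : subring_pair A M.
Hypothesis sAN : subring_pair A N.

Lemma beta_suml I (a x : 'I_I -> R) y : (forall i, a i \in A) ->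
  (forall i, x i \in M) -> y \in N ->
  beta (\sum_i a i * x i) y = \sum_i beta (x i) (a i * y).
Proof.
move=> aA xM yN; have sM := subring_pairB sAM.
suff [_ ->] : \sum_i a i * x i \in M /\
  beta (\sum_i a i * x i) y = \sum_i beta (x i) (a i * y) by [].
apply: (big_ind2 (fun u v => u \in M /\ beta u y = v)).
- split; first exact: subring0.
  by apply: (addrI (beta 0 y)); rewrite -betaDl ?addr0 //; apply: subring0.
- by move=> u1 u2 v1 v2 [uM <-] [vM <-]; split; [exact: subringD|exact: betaDl].
- move=> i _; split; last exact: betaM.
  by apply: subringM => //; apply: (subring_pairS sAM).
Qed.

Lemma beta_sumr I x (y : 'I_I -> R) : x \in M -> (forall i, y i \in N) ->
  beta x (\sum_i y i) = \sum_i beta x (y i).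
Proof.
move=> xM yN; have sN := subring_pairB sAN.
suff [_ ->] : \sum_i y i \in N /\ beta x (\sum_i y i) = \sum_i beta x (y i) by [].
apply: (big_ind2 (fun u v => u \in N /\ beta x u = v)) => //.
- split; first exact: subring0.
  by apply: (addrI (beta x 0)); rewrite -betaDr ?addr0 //; apply: subring0.
- by move=> u1 u2 v1 v2 [uM <-] [vM <-]; split; [exact: subringD|exact: betaDr].
Qed.

End Balanced.
End Tensor.

(** * The lengths of the dihedral elements *)

Lemma perm_flatten_dup (T : eqType) (s : seq T) :
  perm_eq (flatten [seq [:: l; l] | l <- s]) (s ++ s).
Proof.
apply/permP => P; elim: s => //= x s IH.
by rewrite !count_cat /= IH count_cat; lia.
Qed.

(** This is the factorization of the Poincare polynomial as (1 + v^2)(1 + v^2 + ... +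
    v^(2(m-1))). *)
Lemma perm_dihedral_lengths m : (0 < m)%N ->
  perm_eq (dihedral_lengths m) (iota 0 m ++ iota 1 m).
Proof.
case: m => // m _; rewrite /dihedral_lengths /= perm_cons.
have -> : 1%N :: iota 2 m = iota 1 m ++ [:: m.+1].
  by have := iotaD 1 m 1; rewrite addn1 add1n.
rewrite catA perm_cat2r.
exact: perm_flatten_dup.
Qed.

(** * The quadratic extension by one reflection, and composites with it *)

Section QuadraticExtension.
Variables (k : comNzRingType) (n : nat) (cor rt om : 'rV[k]_n).
Hypothesis cor_rt : pairing cor rt = 2.
Hypothesis surj : exists x, pairing x rt = 1.
Hypothesis cor_om : pairing cor om = 1.
Local Notation R := {mpoly k[n]}.
Local Notation d := (demazure cor rt).
Local Notation Inv := (invariants cor rt).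
Implicit Types (A : pred R) (f g : R).

Lemma invariants_subring : subring_closed Inv.
Proof.
split=> [|f g /eqP sf /eqP sg|f g /eqP sf /eqP sg]; apply/eqP.
- exact: actR1.
- by rewrite actRB sf sg.
- by rewrite actRM sf sg.
Qed.

Lemma demazure_trace : linear_trace Inv predT d.
Proof.
split=> [f _|a f g aI _ _]; first exact: demazure_invar.
by rewrite demazureD // demazureMl.
Qed.

Lemma demazure_om : d (linp om) = 1.
Proof. by rewrite demazure_linp // cor_om. Qed.

(** The pair [om_dual], [1] is dual to [1], [linp om]: the product [linp om * om_dual] is minus the
    norm of [linp om], hence invariant and of trace zero. *)
Definition om_dual : R := - actR cor rt (linp om).

Lemma demazure_om_dual : d om_dual = 1.
Proof.
rewrite /om_dual demazureN // actR_linp demazure_linp // pairing_refl cor_rt cor_om.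
by rewrite -rmorphN -[RHS]mpolyC1; congr (_%:MP); ring.
Qed.

Lemma demazure_om_om_dual : d (linp om * om_dual) = 0.
Proof.
apply/invariantsP => //; apply/eqP; rewrite /om_dual actRM actRN actRK // mulrN mulrC.
by rewrite mulrN.
Qed.

Definition quad (u v : R) N (x : 'I_N -> R) (i : 'I_(N + N)) : R :=
  match split i with inl j => u * x j | inr j => v * x j end.

Definition quad_deg p q N (e : 'I_N -> nat) (i : 'I_(N + N)) : nat :=
  match split i with inl j => (p + e j)%N | inr j => (q + e j)%N end.

Lemma quadl u v N (x : 'I_N -> R) j : quad u v x (lshift N j) = u * x j.
Proof. by rewrite /quad (unsplitK (inl j)). Qed.

Lemma quadr u v N (x : 'I_N -> R) j : quad u v x (rshift N j) = v * x j.
Proof. by rewrite /quad (unsplitK (inr j)). Qed.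

Lemma quad_deg_enum m :
  [seq quad_deg 0 1 (@nat_of_ord m) i | i <- enum 'I_(m + m)] = iota 0 m ++ iota 1 m.
Proof.
pose h l := if (l < m)%N then l else (l - m).+1.
have E : quad_deg 0 1 (@nat_of_ord m) =1 h \o val.
  move=> i; rewrite /quad_deg /h /=; case: splitP => j -> //.
  by rewrite addKn.
rewrite (eq_map E) map_comp val_enum_ord iotaD map_cat; congr (_ ++ _).
  rewrite -[RHS]map_id; apply/eq_in_map => l.
  by rewrite mem_iota /h /= => ->.
have -> : iota (0 + m) m = [seq (m + l)%N | l <- iota 0 m] by rewrite -iotaDl addn0.
rewrite (iotaDl 1 0) -map_comp; apply: eq_map => l /=.
by rewrite /h ltnNge leq_addr addKn.
Qed.

Lemma quad_homog u v p q N (x : 'I_N -> R) (e : 'I_N -> nat) i :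
  u \is p.-homog -> v \is q.-homog -> (forall j, x j \is (e j).-homog) ->
  quad u v x i \is (quad_deg p q e i).-homog.
Proof. by move=> hu hv hx; rewrite /quad /quad_deg; case: split => j; apply: dhomogM. Qed.

Section Composite.
Variables (A : pred R) (tau : R -> R).
Hypothesis sA : subring_pair A Inv.
Hypothesis tauP : linear_trace A Inv tau.

Lemma subring_pair_predT : subring_pair A predT.
Proof. by split=> //; case: sA. Qed.

Lemma composite_trace : linear_trace A predT (fun f => tau (d f)).
Proof.
split=> [f _|a f g aA _ _]; first by apply: tauP.1; apply: demazure_invar.
rewrite demazureD // demazureMl ?tauP.2 //; try exact: demazure_invar.
exact: (subring_pairS sA).
Qed.

Lemma quad_spans u v N (x : 'I_N -> R) :
  (forall f, exists f0 f1, [/\ f0 \in Inv, f1 \in Inv & f = f0 * u + f1 * v]) ->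
  spans A Inv x -> spans A predT (quad u v x).
Proof.
move=> uv sx f _; have [f0 [f1 [i0 i1 ->]]] := uv f.
have [c0 [A0 ->]] := sx f0 i0; have [c1 [A1 ->]] := sx f1 i1.
exists (fun i => match split i with inl j => c0 j | inr j => c1 j end); split.
  by move=> i; case: split.
rewrite big_split_ord !mulr_suml /=; congr (_ + _); apply: eq_bigr => j _.
  by rewrite quadl (unsplitK (inl j)) mulrA mulrAC.
by rewrite quadr (unsplitK (inr j)) mulrA mulrAC.
Qed.

(** [d] is linear over the invariants, so [x i * y j] comes out of it and the two-by-two Gram matrix
    of the quadratic extension remains, which is the identity. *)
Lemma quad_dual N (x y : 'I_N -> R) : dual_bases A Inv tau x y ->
  dual_bases A predT (fun f => tau (d f)) (quad 1 (linp om) x) (quad om_dual 1 y).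
Proof.
move=> D; have [xI yI] : (forall i, x i \in Inv) /\ (forall i, y i \in Inv).
  by split=> i; case: (dual_bases_mem i D).
apply: dual_bases_intro => //.
- exact: subring_pair_predT.
- exact: composite_trace.
- apply: quad_spans; last by case: D => [[_ []]].
  (* Since [d (linp om) = 1], subtracting [d f * linp om] leaves an invariant. *)
  move=> f; exists (f - d f * linp om), (d f); split; last by rewrite mulr1 subrK.
    apply/invariantsP => //; rewrite demazureB // demazureMl ?demazure_invar //.
    by rewrite demazure_om mulr1 subrr.
  exact: demazure_invar.
- apply: quad_spans; last by case: D => [_ [[_ []]]].
  move=> f; exists (d f), (f - d f * om_dual); split; last by rewrite mulr1 addrC subrK.
    exact: demazure_invar.
  apply/invariantsP => //; rewrite demazureB // demazureMl ?demazure_invar //.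
  by rewrite demazure_om_dual mulr1 subrr.
- have xyI i j : x i * y j \in Inv by apply: (subringM invariants_subring).
  have dxy u v i j : d (u * x i * (v * y j)) = d (u * v) * (x i * y j).
    by rewrite mulrACA (demazureMr surj _ (xyI i j)).
  have tau0 : tau 0 = 0 by apply: (trace0 sA tauP).
  move=> i j; rewrite -[i]splitK -[j]splitK; case: (split i) (split j) => i' [] j' /=;
    rewrite ?quadl ?quadr dxy.
  + by rewrite mul1r demazure_om_dual mul1r D.2.2 eq_lshift.
  + by rewrite mul1r demazure1 // mul0r tau0 eq_lrshift.
  + by rewrite demazure_om_om_dual mul0r tau0 eq_rlshift.
  + by rewrite mulr1 demazure_om mul1r D.2.2 eq_rshift.
Qed.

(** The quadratic extension contributes [om_dual + linp om], that is, [linp om] minus its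
    reflection, which is the root. *)
Lemma quad_prod N (x y : 'I_N -> R) :
  \sum_i quad 1 (linp om) x i * quad om_dual 1 y i = linp rt * (\sum_i x i * y i).
Proof.
rewrite big_split_ord /= mulr_sumr -big_split; apply: eq_bigr => i _ /=.
rewrite !quadl !quadr /om_dual actR_linp /refl_hs cor_om scale1r linpD linpN.
by ring.
Qed.

End Composite.

(** The composite construction is applied to the trivial extension of the invariants over
    themselves, with basis 1. *)
Lemma invariants_frobenius : graded_frobenius Inv predT d.
Proof.
have sI : subring_pair Inv Inv by split=> //; apply: invariants_subring.
have idP : linear_trace Inv Inv id by [].
have D1 : dual_bases Inv Inv id (fun _ : 'I_1 => 1) (fun _ : 'I_1 => 1).
  have [I1 _ _] := invariants_subring.
  have sp : spans Inv Inv (fun _ : 'I_1 => 1).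
    by move=> f fI; exists (fun=> f); rewrite big_ord1 mulr1.
  by apply: dual_bases_intro => // i j; rewrite !ord1 mulr1.
have h1 (j : 'I_1) : (1 : R) \is 0.-homog by apply: dhomog1.
have hom_dual : om_dual \is 1.-homog by rewrite rpredN actR_linp linp_homog.
have := graded_frobenius_intro demazure_trace (quad_dual sI idP D1).
apply.
- by move=> i; apply: quad_homog (linp_homog om) h1; apply: dhomog1.
- by move=> i; apply: quad_homog hom_dual _ h1; apply: dhomog1.
Qed.

End QuadraticExtension.

(** * The dihedral Frobenius square *)

Section DihedralFrobenius.
Variables (k : comNzRingType) (n : nat) (a : k) (c r om : bool -> 'rV[k]_n).
Variables (m : nat) (u : k).
Hypothesis cr : forall b, pairing (c b) (r b) = 2.
Hypothesis crN : forall b, pairing (c b) (r (~~ b)) = - a.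
Hypothesis surj : forall b, exists x, pairing x (r b) = 1.
Hypothesis c_om : forall b, pairing (c b) (om b) = 1.
Hypothesis cN_om : forall b, pairing (c (~~ b)) (om b) = 0.
Hypothesis m_gt1 : (1 < m)%N.
Hypothesis qm : qnum a m = 0.
Hypothesis qm1 : qnum a m.-1 = 1.
Hypothesis qfactK : u * qfact a m.-1 = 1.

Local Notation R := {mpoly k[n]}.
Implicit Types (f g h : R).

Definition dem b : R -> R := demazure (c b) (r b).
Definition refl_act b : R -> R := actR (c b) (r b).
Local Notation Inv b := (invariants (c b) (r b)).
Definition dihedral_invariants : pred R :=
  fun f => (f \in Inv true) && (f \in Inv false).
Local Notation RW := dihedral_invariants.
Local Notation kap := [the {rmorphism k -> {mpoly k[n]}} of @mpolyC n k].
Local Notation lin := (@linp k n).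
Local Notation trW b := (alt dem b m).
Local Notation trU b := (tr dem m b).

Let gen (Q : R -> Prop) : Q 1 -> (forall x f, Q f -> Q (kap x * f)) ->
  (forall f g, Q f -> Q g -> Q (f + g)) -> (forall phi f, Q f -> Q (lin phi * f)) ->
  forall f, Q f.
Proof.
move=> Q1 QZ QD QX; apply: mpoly_gen_ind => // [x f|i f] Qf.
  by rewrite -mul_mpolyC; apply: QZ.
by rewrite -linp_delta; apply: QX.
Qed.
Let linZ x phi : lin (x *: phi) = kap x * lin phi.
Proof. by rewrite linpZ -mul_mpolyC. Qed.
Let sM b f g : refl_act b (f * g) = refl_act b f * refl_act b g. Proof. exact: actRM. Qed.
Let s_lin b phi : refl_act b (lin phi) = lin (refl_hs (c b) (r b) phi).
Proof. exact: actR_linp. Qed.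
Let sK b f : refl_act b (refl_act b f) = f. Proof. exact: actRK. Qed.
Let dD b f g : dem b (f + g) = dem b f + dem b g. Proof. exact: demazureD. Qed.
Let dM b f g : dem b (f * g) = dem b f * g + refl_act b f * dem b g.
Proof. exact: demazureM. Qed.
Let d_kap b x : dem b (kap x) = 0. Proof. exact: demazureC. Qed.
Let d_lin b phi : dem b (lin phi) = kap (pairing (c b) phi).
Proof. exact: demazure_linp. Qed.
Let dK b f : dem b (dem b f) = 0. Proof. exact: demazureK. Qed.

Lemma InvP b f : reflect (dem b f = 0) (f \in Inv b).
Proof. exact: invariantsP. Qed.

Let d_inv b f : dem b f = 0 <-> refl_act b f = f.
Proof.
split=> [f0|sf]; first by apply/eqP; apply/(InvP b f).
by apply/InvP; apply/eqP.
Qed.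

Lemma RWP f : reflect (forall e, dem e f = 0) (f \in RW).
Proof.
apply: (iffP andP) => [[/InvP ft /InvP ff] [] //|f0].
by split; apply/InvP.
Qed.

Lemma RW_Inv b : {subset RW <= Inv b}.
Proof. by move=> f /RWP f0; apply/InvP. Qed.

Let braidE b e f : trW b f = trW e f :=
  braid_any cr crN gen s_lin dD dM d_kap d_lin dK d_inv m_gt1 qm qm1 b e f.

Lemma trW_any b e f : trW b f = trW e f. Proof. exact: braidE. Qed.

Lemma RW_subring : subring_closed RW.
Proof.
have [T1 TB TM] := invariants_subring (c true) (r true).
have [F1 FB FM] := invariants_subring (c false) (r false).
split=> [|f g /andP[ft ff] /andP[gt gf]|f g /andP[ft ff] /andP[gt gf]]; apply/andP.
- exact (conj T1 F1).
- by split; [exact: (TB f g ft gt)|exact: (FB f g ff gf)].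
- by split; [exact: (TM f g ft gt)|exact: (FM f g ff gf)].
Qed.

Lemma RW_pair b : subring_pair RW (Inv b).
Proof.
by split; [exact: RW_subring | exact: invariants_subring | exact: RW_Inv].
Qed.

Lemma RW_pair_predT : subring_pair RW predT.
Proof. by split=> //; apply: RW_subring. Qed.

Lemma trU_trace b : linear_trace RW (Inv b) (trU b).
Proof.
split=> [f /InvP f0|x f g /RWP x0 _ _].
  by apply/RWP; apply: (tr_inv cr crN gen s_lin dD dM d_kap d_lin dK d_inv).
by rewrite /tr (demWD dD) (demWM dM d_inv).
Qed.

Lemma trU_dem b f : trU b (dem b f) = trW b f.
Proof. exact: tr_d. Qed.

Lemma trW_trace b : linear_trace RW predT (trW b).
Proof.
split=> [f _|x f g /RWP x0 _ _].
  by rewrite -trU_dem; apply: (trU_trace b).1; apply: demazure_invar.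
by rewrite (demWD dD) (demWM dM d_inv).
Qed.

Lemma dual_bases_Inv b : exists x y : 'I_m -> R,
  [/\ dual_bases RW (Inv b) (trU b) x y, forall i, x i \is (nat_of_ord i).-homog &
      forall i, y i \is (m.-1 - i)%N.-homog].
Proof.
pose hom i f := is_true (f \is i.-homog).
have hom0 i : hom i 0 by apply: dhomog0.
have homB i f g : hom i f -> hom i g -> hom i (f - g) by apply: rpredB.
have homM i j f g : hom i f -> hom j g -> hom (i + j)%N (f * g) by apply: dhomogM.
have hom_kap x : hom 0%N (kap x).
  by rewrite /hom -[kap x]mulr1 mul_mpolyC; apply: rpredZ; apply: dhomog1.
have hom_lin phi : hom 1%N (lin phi) by apply: linp_homog.
have hom_d e i f : hom i.+1 f -> hom i (dem e f) by apply: demazure_homog.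
have [x [y [Hx Hy sx sy E]]] :=
  arc_frobenius cr crN gen sM s_lin sK dD dM d_kap d_lin dK d_inv m_gt1 qm qm1
    c_om cN_om qfactK hom0 homB homM hom_kap hom_lin hom_d b.
have sp (z : 'I_m -> R) : (forall f, dem b f = 0 -> exists c0 : 'I_m -> R,
    (forall i e, dem e (c0 i) = 0) /\ f = \sum_i c0 i * z i) -> spans RW (Inv b) z.
  move=> H f /InvP /H[c0 [c0W ->]]; exists c0; split=> // i.
  by apply/RWP.
exists x, y; split=> [|i|i]; [|by case: (Hx i)|by case: (Hy i)].
apply: dual_bases_intro => //; try by apply: sp.
- exact: RW_pair.
- exact: trU_trace.
- by move=> i; apply/InvP; case: (Hx i).
- by move=> i; apply/InvP; case: (Hy i).
Qed.

Lemma Inv_frobenius b : graded_frobenius RW (Inv b) (trU b).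
Proof.
have [x [y [D hx hy]]] := dual_bases_Inv b.
exact: (graded_frobenius_intro (trU_trace b) D hx hy).
Qed.

Lemma dual_bases_predT b : exists x y : 'I_(m + m) -> R,
  [/\ dual_bases RW predT (trW b) x y,
      forall i, x i \is (quad_deg 0 1 (@nat_of_ord m) i).-homog &
      forall i, y i \is (quad_deg 1 0 (fun j : 'I_m => (m.-1 - j)%N) i).-homog].
Proof.
have [x [y [D hx hy]]] := dual_bases_Inv b.
exists (quad 1 (lin (om b)) x), (quad (om_dual (c b) (r b) (om b)) 1 y); split=> [|i|i].
- apply: dual_bases_eq (quad_dual _ _ _ (RW_pair b) (trU_trace b) D) => //.
  exact: trU_dem.
- by apply: quad_homog => //; [exact: dhomog1|exact: linp_homog].
- apply: quad_homog => //; last exact: dhomog1.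
  by rewrite rpredN actR_linp linp_homog.
Qed.

Lemma predT_frobenius b : graded_frobenius RW predT (trW b).
Proof.
have [x [y [D hx hy]]] := dual_bases_predT b.
exact: (graded_frobenius_intro (trW_trace b) D hx hy).
Qed.

Local Notation posR b := (pos_roots c r lin m b).

Lemma dem_RW b x f : x \in RW -> dem b (x * f) = x * dem b f.
Proof. by move/RWP => x0; apply: (ddiffMl dM d_inv). Qed.

Lemma Inv_euler b N (x y : 'I_N -> R) : dual_bases RW (Inv b) (trU b) x y ->
  lin (r b) * (\sum_i x i * y i) = posR b.
Proof.
move=> D; have yI i := (dual_bases_mem i D).2.
apply: (euler_elem cr crN (@linpD _ _) linZ s_lin dD dM d_kap d_lin dK d_inv
          m_gt1 qm qm1 c_om cN_om qfactK).
- by move=> i; apply/InvP.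
- have I1 : 1 \in Inv b by case: (invariants_subring (c b) (r b)).
  rewrite [RHS](dual_expandl (RW_pair b) (trU_trace b) D I1).
  by apply: eq_bigr => i _; rewrite mul1r mulrC.
- move=> z j /InvP zI; apply: (dual_commute (RW_pair b) (trU_trace b) D) => //.
    by move=> f g; apply: (demWD dD).
  by move=> x0 f /RWP xW; apply: (demWM dM d_inv).
Qed.

(** The weight [om (~~ b)] is invariant under [b], so [dual_commute] pulls it out of the sum, while
    the Leibniz rule gives d(o y) = y + s(o) d(y). Comparing leaves the factor o - s(o), the root of
    [~~ b]. *)
Lemma Inv_euler_dem b N (x y : 'I_N -> R) : dual_bases RW (Inv b) (trU b) x y ->
  lin (r (~~ b)) * (\sum_i x i * dem (~~ b) (y i)) = \sum_i x i * y i.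
Proof.
move=> D; have oI : lin (om (~~ b)) \in Inv b.
  by apply/InvP; rewrite d_lin -{1}(negbK b) cN_om (rmorph0 kap).
set S := \sum_i x i * dem (~~ b) (y i); set o := lin (om (~~ b)) in oI.
have E : \sum_i x i * y i + refl_act (~~ b) o * S = o * S.
  rewrite -[RHS](dual_commute (RW_pair b) (trU_trace b) D (dD (~~ b)) (@dem_RW (~~ b)) oI).
  rewrite /S mulr_sumr -big_split; apply: eq_bigr => i _ /=.
  by rewrite dM d_lin c_om (rmorph1 kap) mul1r mulrDr [in RHS]mulrCA.
have -> : lin (r (~~ b)) = o - refl_act (~~ b) o.
  by rewrite /o s_lin /refl_hs c_om scale1r linpD linpN opprD opprK addrA subrr add0r.
by rewrite mulrBl -E addrK.
Qed.

(** The sum does not depend on the bases; for product bases [quad_prod] splits off the simple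
    root. *)
Lemma predT_euler b N (x y : 'I_N -> R) : dual_bases RW predT (trW b) x y ->
  \sum_i x i * y i = posR b.
Proof.
move=> D; have [x0 [y0 [D0 _ _]]] := dual_bases_Inv b.
have D' : dual_bases RW predT (trW b) (quad 1 (lin (om b)) x0)
    (quad (om_dual (c b) (r b) (om b)) 1 y0).
  apply: dual_bases_eq (quad_dual _ _ _ (RW_pair b) (trU_trace b) D0) => //.
  exact: trU_dem.
rewrite (dual_prod_indep RW_pair_predT (trW_trace b) D D').
by rewrite quad_prod ?Inv_euler.
Qed.

Lemma trW_pos_roots b : trW b (posR b) = (2 * m)%:R.
Proof.
have [x [y [D _ _]]] := dual_bases_predT b.
rewrite -(predT_euler D) (trace_dual_prod RW_pair_predT (trW_trace b) D).
by rewrite mul2n -addnn.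
Qed.

(** The given bases have an unspecified length [N]; passing to bases indexed by ['I_m] produces the
    value [m]. *)
Lemma trU_euler b N (x y : 'I_N -> R) : dual_bases RW (Inv b) (trU b) x y ->
  trU b (\sum_i x i * y i) = m%:R.
Proof.
move=> D; have [x0 [y0 [D0 _ _]]] := dual_bases_Inv b.
rewrite (dual_prod_indep (RW_pair b) (trU_trace b) D D0).
exact: (trace_dual_prod (RW_pair b) (trU_trace b) D0).
Qed.

(** * The map to the tensor product of the two invariant rings *)

Section BimoduleMap.
Variable b : bool.
Local Notation tens := (tensor_eq RW (Inv b) (Inv (~~ b))).

(* Both sides equal
   [\sum_(i, j) trW (f * x' i * y j) . x i (x) y' j]. *)
Lemma bimodule_map_swap N (x x' : 'I_N -> R) M (y y' : 'I_M -> R) f :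
  dual_bases RW (Inv b) (trU b) x x' ->
  dual_bases RW (Inv (~~ b)) (trU (~~ b)) y y' ->
  tens [seq (x i, dem (~~ b) (f * x' i)) | i <- enum 'I_N]
       [seq (dem b (f * y j), y' j) | j <- enum 'I_M].
Proof.
move=> Dx Dy; have xI i := dual_bases_mem i Dx; have yI j := dual_bases_mem j Dy.
split; [|split].
- apply/allP => p /mapP[i _ ->] /=; rewrite (xI i).1 /=; exact: demazure_invar.
- apply/allP => p /mapP[j _ ->] /=; rewrite (yI j).2 andbT; exact: demazure_invar.
move=> P beta bDl bDr bM; rewrite !sum_map_enum /=.
have dE i : dem (~~ b) (f * x' i) = \sum_j trW b (f * x' i * y j) * y' j.
  rewrite [LHS](dual_expandr (RW_pair (~~ b)) (trU_trace (~~ b)) Dy); last first.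
    exact: demazure_invar.
  apply: eq_bigr => j _; congr (_ * _).
  rewrite (braidE b (~~ b)) -trU_dem [f * x' i * _]mulrC; congr (tr _ _ _ _).
  by symmetry; apply: (ddiffMl dM d_inv); apply/InvP; case: (yI j).
have dE' j : dem b (f * y j) = \sum_i trW b (f * x' i * y j) * x i.
  rewrite [LHS](dual_expandl (RW_pair b) (trU_trace b) Dx); last first.
    exact: demazure_invar.
  apply: eq_bigr => i _; congr (_ * _).
  rewrite -trU_dem [f * x' i * _]mulrAC; congr (tr _ _ _ _).
  by symmetry; apply: (ddiffMr dM d_inv); apply/InvP; case: (xI i).
have tW g : trW b g \in RW by apply: (trW_trace b).1.
under eq_bigr => i _.
  rewrite dE (beta_sumr bDr (RW_pair _) (xI i).1); last first.
    by move=> j; apply: subringM (invariants_subring _ _) _ (yI j).2; apply: RW_Inv.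
  over.
under [RHS]eq_bigr => j _.
  rewrite dE' (beta_suml bDl bM (RW_pair _)) //; last exact: (yI j).2.
    over.
  by move=> i; apply: (xI i).1.
by rewrite exchange_big.
Qed.

(** Both sides are compared with one expression in dual bases for the other reflection. *)
Lemma bimodule_map_indep N (x x' : 'I_N -> R) M (y y' : 'I_M -> R) f :
  dual_bases RW (Inv b) (trU b) x x' -> dual_bases RW (Inv b) (trU b) y y' ->
  tens [seq (x i, dem (~~ b) (f * x' i)) | i <- enum 'I_N]
       [seq (y i, dem (~~ b) (f * y' i)) | i <- enum 'I_M].
Proof.
move=> Dx Dy; have [z [z' [Dz _ _]]] := dual_bases_Inv (~~ b).
apply: tensor_eq_trans (bimodule_map_swap f Dx Dz) _.
exact/tensor_eq_sym/bimodule_map_swap.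
Qed.

(** The same coefficients [t j i] expand [g * x' i] in the family [x'] and [g * x j] in the family
    [x]; they lie in [RW], so they cross the tensor sign. The factor [h] leaves [dem (~~ b)] by
    linearity. *)
Lemma bimodule_map_bilinear N (x x' : 'I_N -> R) f f' g h :
  dual_bases RW (Inv b) (trU b) x x' -> g \in Inv b -> h \in Inv (~~ b) ->
  tens [seq (x i, dem (~~ b) ((g * f * h + f') * x' i)) | i <- enum 'I_N]
       ([seq (g * x i, dem (~~ b) (f * x' i) * h) | i <- enum 'I_N] ++
        [seq (x i, dem (~~ b) (f' * x' i)) | i <- enum 'I_N]).
Proof.
move=> D gI hI; have xI i := dual_bases_mem i D.
have dI e f0 : dem e f0 \in Inv e by apply: demazure_invar.
have IM e f1 f2 : f1 \in Inv e -> f2 \in Inv e -> f1 * f2 \in Inv e.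
  exact: (subringM (invariants_subring (c e) (r e))).
split; [|split].
- by apply/allP => p /mapP[i _ ->] /=; rewrite (xI i).1 dI.
- rewrite all_cat; apply/andP; split; apply/allP => p /mapP[i _ ->] /=.
    by rewrite (IM _ _ _ gI (xI i).1) (IM _ _ _ (dI _ _) hI).
  by rewrite (xI i).1 dI.
move=> P beta bDl bDr bM; rewrite big_cat !sum_map_enum /=.
pose t j i := trU b (x j * (g * x' i)).
have tW j i : t j i \in RW.
  apply: (trU_trace b).1; exact: (IM _ _ _ (xI j).1 (IM _ _ _ gI (xI i).2)).
pose z j := dem (~~ b) (f * x' j) * h.
have zI j : z j \in Inv (~~ b) := IM _ _ _ (dI _ _) hI.
have dE i : dem (~~ b) ((g * f * h + f') * x' i) =
    \sum_j t j i * z j + dem (~~ b) (f' * x' i).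
  rewrite mulrDl dD; congr (_ + _).
  have -> : g * f * h * x' i = (\sum_j t j i * (f * x' j)) * h.
    have := dual_expandr (RW_pair b) (trU_trace b) D (IM b _ _ gI (xI i).2).
    have -> : g * f * h * x' i = f * (g * x' i) * h by ring.
    move=> {1}->; congr (_ * _); rewrite mulr_sumr; apply: eq_bigr => j _.
    exact: mulrCA.
  rewrite (ddiffMr dM d_inv _ (elimT (InvP _ _) hI)).
  rewrite (big_morph _ (dD (~~ b)) (ddiff0 d_kap (~~ b))) mulr_suml.
  by apply: eq_bigr => j _; rewrite dem_RW // mulrA.
have gx j : g * x j = \sum_i t j i * x i.
  rewrite [LHS](dual_expandl (RW_pair b) (trU_trace b) D (IM b _ _ gI (xI j).1)).
  by apply: eq_bigr => i _; congr (trU b _ * _); rewrite mulrCA mulrA.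
have tzI i j : t j i * z j \in Inv (~~ b) by exact: (IM _ _ _ (RW_Inv _ (tW j i)) (zI j)).
have betaE i : beta (x i) (dem (~~ b) ((g * f * h + f') * x' i)) =
    \sum_j beta (x i) (t j i * z j) + beta (x i) (dem (~~ b) (f' * x' i)).
  have szI := subring_sum (invariants_subring _ _) (tzI i).
  rewrite dE (bDr _ _ _ (xI i).1 szI (dI _ _)).
  by rewrite (beta_sumr bDr (RW_pair _) (xI i).1 (tzI i)).
rewrite (eq_bigr _ (fun i _ => betaE i)).
rewrite big_split /=; congr (_ + _); rewrite exchange_big; apply: eq_bigr => j _ /=.
rewrite gx; exact/esym/(beta_suml bDl bM (RW_pair b) (tW j) (fun i => (xI i).1) (zI j)).
Qed.

End BimoduleMap.
End DihedralFrobenius.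

Theorem theorem3p32 (k : comUnitRingType) (n m : nat) (a2 : k)
    (acs act as_ at_ : 'rV[k]_n) :
  (2 <= m)%N ->
  (* balanced symmetric realization *)
  pairing acs as_ = 2 -> pairing act at_ = 2 ->
  pairing acs at_ = - a2 -> pairing act as_ = - a2 ->
  qnum a2 m = 0 -> qnum a2 m.-1 = 1 ->
  (* s, t define a W-action on h *)
  (forall x, refl_h acs as_ (refl_h acs as_ x) = x) ->
  (forall x, refl_h act at_ (refl_h act at_ x) = x) ->
  (forall x, iter m (fun y => refl_h acs as_ (refl_h act at_ y)) x = x) ->
  (* Demazure surjectivity *)
  (exists x, pairing x as_ = 1) -> (exists x, pairing x at_ = 1) ->
  (exists phi, pairing acs phi = 1) -> (exists phi, pairing act phi = 1) ->
  (* local non-degeneracy *)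
  (4 - a2 ^+ 2) \is a GRing.unit ->
  (* lesser invertibility *)
  (forall j, (1 <= j < m)%N -> qnum a2 j \is a GRing.unit) ->
  (exists x, refl_h acs as_ x != x) -> (exists x, refl_h act at_ x != x) ->
  (forall j, (0 < j < m)%N ->
     exists x, iter j (fun y => refl_h acs as_ (refl_h act at_ y)) x != x) ->
  let ds := demazure acs as_ in
  let dt := demazure act at_ in
  let Rs := invariants acs as_ in
  let Rt := invariants act at_ in
  let RW : pred {mpoly k[n]} := fun f => (f \in Rs) && (f \in Rt) in
  let dW := altL ds dt m in             (* d_s d_t ... (m factors) *)
  let dWs := altF dt ds m.-1 in         (* m-1 factors, d_t applied first *)
  let dWt := altF ds dt m.-1 in         (* m-1 factors, d_s applied first *)
  let Lam := Lambda m acs act as_ at_ in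
  (* compatible graded Frobenius square *)
  [/\ graded_frobenius Rs predT ds, graded_frobenius Rt predT dt,
      graded_frobenius RW Rs dWs, graded_frobenius RW Rt dWt &
      graded_frobenius RW predT dW] /\
  (forall f, dWs (ds f) = dW f /\ dWt (dt f) = dW f) /\
  (* R(m) is free over R^W of graded rank [W] *)
  (exists N (b : 'I_N -> {mpoly k[n]}) (d : 'I_N -> nat),
      graded_basis RW predT b d /\
      perm_eq [seq (2 * d i)%:Z - m%:Z | i <- enum 'I_N] (W_exponents m)) /\
  (* R^s(m-1), R^t(m-1) are free over R^W of graded rank [W]/(v+v^-1) *)
  (forall Ri : pred {mpoly k[n]}, (Ri = Rs \/ Ri = Rt) ->
    exists N (b : 'I_N -> {mpoly k[n]}) (d : 'I_N -> nat),
      graded_basis RW Ri b d /\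
      let e := [seq (2 * d i)%:Z - (m.-1)%:Z | i <- enum 'I_N] in
      perm_eq ([seq x + 1 | x <- e] ++ [seq x - 1 | x <- e]) (W_exponents m)) /\
  (* (1) and (2) *)
  (forall N (b b' : 'I_N -> {mpoly k[n]}), dual_bases RW predT dW b b' ->
      \sum_(i < N) b i * b' i = Lam) /\
  dW Lam = (2 * m)%:R /\
  (* (3), (4), (5) *)
  (forall N (b b' : 'I_N -> {mpoly k[n]}), dual_bases RW Rs dWs b b' ->
      [/\ linp as_ * (\sum_(i < N) b i * b' i) = Lam,
          dWs (\sum_(i < N) b i * b' i) = m%:R,
          linp as_ * linp at_ * (\sum_(i < N) b i * dt (b' i)) = Lam &
          linp as_ * linp at_ * (\sum_(i < N) dt (b i) * b' i) = Lam]) /\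
  (* (6) and the induced map R -> R^s (x)_{R^W} R^t *)
  (forall N (b b' : 'I_N -> {mpoly k[n]}) N' (c c' : 'I_N' -> {mpoly k[n]}),
      dual_bases RW Rs dWs b b' -> dual_bases RW Rt dWt c c' ->
      forall f, tensor_eq RW Rs Rt
        [seq (b i, dt (f * b' i)) | i <- enum 'I_N]
        [seq (ds (f * c j), c' j) | j <- enum 'I_N']) /\
  (forall N (b b' : 'I_N -> {mpoly k[n]}) N2 (b2 b2' : 'I_N2 -> {mpoly k[n]}),
      dual_bases RW Rs dWs b b' -> dual_bases RW Rs dWs b2 b2' ->
      forall f f' g h, g \in Rs -> h \in Rt ->
      tensor_eq RW Rs Rt
        [seq (b i, dt (f * b' i)) | i <- enum 'I_N]
        [seq (b2 i, dt (f * b2' i)) | i <- enum 'I_N2] /\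
      tensor_eq RW Rs Rt
        [seq (b i, dt ((g * f * h + f') * b' i)) | i <- enum 'I_N]
        ([seq (g * b i, dt (f * b' i) * h) | i <- enum 'I_N] ++
         [seq (b i, dt (f' * b' i)) | i <- enum 'I_N])).
Proof.
move=> m2 cs ct cst cts qm qm1 _ _ _ ss st _ _ nd qU _ _ _ ds dt Rs Rt RW dW dWs dWt Lam.
pose c b := if b then acs else act; pose r b := if b then as_ else at_.
have cr b : pairing (c b) (r b) = 2 by case: b.
have crN b : pairing (c b) (r (~~ b)) = - a2 by case: b.
have crN' b : pairing (c (~~ b)) (r b) = - a2 by case: b.
have surj b : exists x, pairing x (r b) = 1 by case: b.
(* Cramer's rule for the Cartan matrix, of determinant [4 - a2 ^+ 2]. *)
pose om b := (4 - a2 ^+ 2)^-1 *: (2 *: r b + a2 *: r (~~ b)).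
have c_om b : pairing (c b) (om b) = 1.
  rewrite pairingZ pairingD !pairingZ cr crN -[RHS](mulVr nd); congr (_ * _); ring.
have cN_om b : pairing (c (~~ b)) (om b) = 0.
  rewrite pairingZ pairingD !pairingZ cr crN'.
  by rewrite [2 * _]mulrC mulNr addNr mulr0.
have /mulVr qfactK : qfact a2 m.-1 \is a GRing.unit.
  apply: rpred_prod => i _; apply: qU; rewrite ltnS /=.
  by have := ltn_ord i; lia.
pose F := alt (dem c r); pose T := tr (dem c r) m.
(* [dW] has s as leftmost letter, so its first letter depends on the parity of [m]; the braid
   relation removes this dependence. *)
have dWE : F true m =1 dW.
  move=> f; rewrite /dW (altL_alt (dem c r) true m f).
  exact: (trW_any cr crN surj m2 qm qm1).
have TF b f : T b (dem c r b f) = F true m f.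
  transitivity (F b m f); first exact: (tr_d (dem c r) m2 b f).
  exact: (trW_any cr crN surj m2 qm qm1 b true f).
split; [|split; [|split; [|split; [|split; [|split; [|split; [|split]]]]]]].
- split.
  + exact: (invariants_frobenius cs ss (c_om true)).
  + exact: (invariants_frobenius ct st (c_om false)).
  + exact: (Inv_frobenius cr crN surj c_om cN_om m2 qm qm1 qfactK true).
  + exact: (Inv_frobenius cr crN surj c_om cN_om m2 qm qm1 qfactK false).
  + apply: graded_frobenius_eq dWE _.
    exact: (predT_frobenius cr crN surj c_om cN_om m2 qm qm1 qfactK true).
- by move=> f; rewrite -dWE; split; [exact: (TF true)|exact: (TF false)].
- have [x [y [D hx _]]] :=
    dual_bases_predT cr crN surj c_om cN_om m2 qm qm1 qfactK true.
  exists (m + m)%N, x, (quad_deg 0 1 (@nat_of_ord m)); split; first by split; [case: D|].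
  rewrite (map_comp (fun l => (2 * l)%:Z - m%:Z)) quad_deg_enum perm_sym.
  by apply: perm_map; apply: perm_dihedral_lengths; lia.
- move=> Ri RiE.
  have basis b : exists x : 'I_m -> {mpoly k[n]},
      graded_basis RW (invariants (c b) (r b)) x (@nat_of_ord m).
    have [x [y [D hx _]]] := dual_bases_Inv cr crN surj c_om cN_om m2 qm qm1 qfactK b.
    by exists x; split=> //; case: D.
  have [x gx] : exists x, graded_basis RW Ri x (@nat_of_ord m).
    by case: RiE => ->; [exact: (basis true)|exact: (basis false)].
  exists m, x, (@nat_of_ord m); split=> //=.
  (* Multiplication by v + v^(-1) shifts the exponents both ways: downwards they come from the
     lengths 0, ..., m-1, upwards from 1, ..., m. *)
  have E0 : [seq y - 1 | y <- [seq (2 * i)%:Z - m.-1%:Z | i : 'I_m <- enum 'I_m]] =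
      [seq (2 * l)%:Z - m%:Z | l <- iota 0 m].
    rewrite -val_enum_ord -!map_comp; apply: eq_map => i /=; lia.
  have E1 : [seq y + 1 | y <- [seq (2 * i)%:Z - m.-1%:Z | i : 'I_m <- enum 'I_m]] =
      [seq (2 * l)%:Z - m%:Z | l <- iota 1 m].
    rewrite (iotaDl 1 0) -val_enum_ord -!map_comp; apply: eq_map => i /=; lia.
  rewrite E0 E1 -map_cat perm_sym; apply: perm_map.
  by rewrite perm_sym perm_catC perm_sym; apply: perm_dihedral_lengths; lia.
- move=> N b b' D.
  apply: (predT_euler cr crN surj c_om cN_om m2 qm qm1 qfactK (b := true)).
  exact: dual_bases_eq (fsym dWE) D.
- rewrite -dWE; exact: (trW_pos_roots cr crN surj c_om cN_om m2 qm qm1 qfactK true).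
- move=> N b b' D.
  have Es : linp as_ * (\sum_(i < N) b i * b' i) = Lam :=
    Inv_euler cr crN surj c_om cN_om m2 qm qm1 qfactK (b := true) D.
  have D' := dual_bases_sym D.
  have Et (x y : 'I_N -> {mpoly k[n]}) : dual_bases RW Rs dWs x y ->
      linp at_ * (\sum_(i < N) x i * dt (y i)) = \sum_(i < N) x i * y i :=
    Inv_euler_dem cr crN surj c_om cN_om m2 qm qm1 (b := true) (x := x) (y := y).
  split=> //.
  + exact: (trU_euler cr crN surj c_om cN_om m2 qm qm1 qfactK (b := true) D).
  + by rewrite -mulrA Et.
  (* The second form of (5) is the first one for the dual bases in exchanged order. *)
  + rewrite -mulrA (eq_bigr (fun i => b' i * dt (b i))) => [|i _]; last exact: mulrC.
    by rewrite Et // -Es; congr (_ * _); apply: eq_bigr => i _; rewrite mulrC.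
- move=> N b b' N' c1 c1' D D' f.
  exact: (bimodule_map_swap cr crN surj m2 qm qm1 (b := true) f D D').
- move=> N b b' N2 b2 b2' D D2 f f' g h gs ht; split.
    exact: (bimodule_map_indep cr crN surj c_om cN_om m2 qm qm1 qfactK (b := true) f D D2).
  exact: (bimodule_map_bilinear cr crN surj m2 qm qm1 (b := true) f f' D gs ht).
Qed.
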